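(* Let $r\ge 2$ be an integer, let $w(x)=x^\alpha(1-x)^\beta$ with $\alpha,\beta>0$, and let $\phi$ be an admissible step-weight function with exponents $\beta(0),\beta(1)$ satisfying $\min\{\beta(0),\beta(1)\}\ge \frac12$. Then there is a constant $C>0$, independent of $n$, $x$ and $f$, such that for every $f\in W_\phi^r$, every admissible $n$ and every $x\in[0,1]$, $$\left|w(x)\phi^{r}(x)\,B^{\ast(r)}_{n,r-1}(f,x)\right|\le C\,\|w\phi^{r}f^{(r)}\|,$$ where $B^{\ast(r)}_{n,r-1}(f,x)$ denotes the $r$-th derivative in $x$ of $B^{\ast}_{n,r-1}(f,x)$.
   Context: Weights and spaces: $w(x)=x^\alpha(1-x)^\beta$ on $[0,1]$. $C_w$ is the set of $f\in C((0,1))$ with $\lim_{x\to0}(wf)(x)=\lim_{x\to1}(wf)(x)=0$; $\|\cdot\|$ is the (essential) supremum norm on $(0,1)$. $W_\phi^r=\{f\in C_w: f^{(r-1)}\in A.C.((0,1)),\ \|w\phi^rf^{(r)}\|<\infty\}$, where $A.C.((0,1))$ means locally absolutely continuous on $(0,1)$. Admissible step-weight function: $\phi:[0,1]\to\mathbb R$ such that (I) for every $[a,b]\subset(0,1)$ there is $M_1=M(a,b)>0$ with $M_1^{-1}\le\phi(x)\le M_1$ on $[a,b]$; (II) there are numbers $\beta(0),\beta(1)\ge0$ with $\phi(x)\sim x^{\beta(0)}$ as $x\to0+$ and $\phi(x)\sim(1-x)^{\beta(1)}$ as $x\to1-$ ($X\sim Y$ means $C^{-1}Y\le X\le CY$ for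 some $C>0$). Consequently $M^{-1}x^{\beta(0)}(1-x)^{\beta(1)}\le\phi(x)\le Mx^{\beta(0)}(1-x)^{\beta(1)}$ on $[0,1]$ for some constant $M>0$. Bernstein operators: $B_m(g,x)=\sum_{k=0}^m g(k/m)\binom mk x^k(1-x)^{m-k}$. For an integer $s\ge1$, the combinations are $B_{n,s}(g,x)=\sum_{i=0}^{s-1}C_i(n)B_{n_i}(g,x)$, where the integers $n_i=n_i(n)$ and reals $C_i(n)$ are fixed and satisfy, with an absolute constant $C$ independent of $n$: (a) $n=n_0<n_1<\dots<n_{s-1}\le Cn$; (b) $\sum_{i}|C_i(n)|\le C$; (c) $\sum_i C_i(n)=1$; (d) $\sum_i C_i(n)n_i^{-k}=0$ for $k=1,\dots,s-1$. Modified function: fix a non-decreasing $\psi\in C^\infty(\mathbb R)$ with $\psi=0$ on $(-\infty,0]$ and $\psi=1$ on $[1,\infty)$. For $n>\max\{r,3\}$ (the admissible $n$) let $L_r(f,x)=\sum_{i=1}^r f(i/n)\,l_i(x)$ be the Lagrange polynomial of degree $\le r-1$ interpolating $f$ at $i/n$, $i=1,\dots,r$, and $R_r(f,x)$ the one interpolating $f$ at $1-i/n$, $i=1,\dots,r$. Define $F_n(x)=F_n(f,x)$ by $$F_n(x)=\begin{cases} L_r(f,x), & x\in[0,\frac1n], \\ (1-\psi(nx-1))L_r(f,x)+\psi(nx-1)f(x), & x\in[\frac1n,\frac2n], \\ f(x), & x\in[\frac2n,1-\frac2n], \\ (1-\psi(n(1-x)-1))R_r(f,x)+\psi(n(1-x)-1)f(x),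 & x\in[1-\frac2n,1-\frac1n], \\ R_r(f,x), & x\in[1-\frac1n,1]. \end{cases}$$ Finally $B^\ast_{n,r-1}(f,x)=B_{n,r-1}(F_n,x)$. Constants may depend on $r,\alpha,\beta,\phi,\psi$ and the constant in (a),(b). *)

(* Defs.v *)
From HB Require Import structures.
From mathcomp Require Import all_boot all_order all_algebra.
From mathcomp Require Import all_classical all_reals all_analysis.

Set Implicit Arguments.
Unset Strict Implicit.
Unset Printing Implicit Defensive.

Import Order.TTheory GRing.Theory Num.Theory.
Import numFieldNormedType.Exports.

Local Open Scope classical_set_scope.
Local Open Scope ring_scope.

(* Functions on (0,1) or [0,1] are represented by total functions R -> R; no
   definition below depends on their values outside that interval. *)

Section Spaces.
Context {R : realType}.
Implicit Types (f g phi psi : R -> R) (r : nat).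

Definition jacobi_weight (alpha beta : R) : R -> R :=
  fun x => x `^ alpha * (1 - x) `^ beta.

Definition in_Cw (w : R -> R) f : Prop :=
  [/\ {in `]0, 1[, continuous f},
      (w x * f x) @[x --> 0^'+] --> (0 : R) &
      (w x * f x) @[x --> 1^'-] --> (0 : R)].

Definition esssup_norm01 g : \bar R :=
  'N[@lebesgue_measure R]_+oo%E[(EFin \o g) \_ `]0, 1[%classic].

(* Absolute continuity on [a, b]; a subinterval [s.1, s.2] is coded by the
   pair s of its endpoints. *)
Definition abs_continuous (a b : R) g : Prop :=
  forall e : R, 0 < e -> exists2 d : R, 0 < d &
    forall (m : nat) (s : 'I_m -> R * R),
      (forall i, [&& a <= (s i).1, (s i).1 <= (s i).2 & (s i).2 <= b]) ->
      (forall i j, i != j ->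
         `](s i).1, (s i).2[ `&` `](s j).1, (s j).2[ = set0) ->
      \sum_(i < m) ((s i).2 - (s i).1) < d ->
      \sum_(i < m) `|g (s i).2 - g (s i).1| < e.

Definition loc_abs_continuous01 g : Prop :=
  forall a b : R, 0 < a -> a < b -> b < 1 -> abs_continuous a b g.

(* The first two clauses say that the (r-1)-st derivative of f exists
   everywhere on (0,1) and is locally absolutely continuous there; the r-th
   derivative then exists almost everywhere, which is enough for the essential
   supremum (derive1n takes junk values only on a null set). *)
Definition in_Wphi (w phi : R -> R) r f : Prop :=
  [/\ in_Cw w f,
      (forall k, (k < r.-1)%N -> {in `]0, 1[, forall x, derivable (derive1n k f) x 1}),
      loc_abs_continuous01 (derive1n r.-1 f) &
      (esssup_norm01 (fun x => w x * phi x ^+ r * derive1n r f x)%R < +oo)%E].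

Definition sim_at (F : set_system R) (X Y : R -> R) : Prop :=
  exists2 C : R, 0 < C & \forall x \near F, C^-1 * Y x <= X x <= C * Y x.

Definition step_weight phi (b0 b1 : R) : Prop :=
  [/\ (forall a b : R, 0 < a -> a <= b -> b < 1 ->
         exists2 M : R, 0 < M & {in `[a, b], forall x, M^-1 <= phi x <= M}),
      0 <= b0, 0 <= b1,
      sim_at 0^'+ phi (fun x => x `^ b0) &
      sim_at 1^'- phi (fun x => (1 - x) `^ b1)].

Definition smooth_cutoff psi : Prop :=
  [/\ {homo psi : x y / x <= y},
      (forall (k : nat) (x : R), derivable (derive1n k psi) x 1),
      (forall x, x <= 0 -> psi x = 0) &
      (forall x, 1 <= x -> psi x = 1)].

End Spaces.

Section Operators.
Context {R : realType}.
Implicit Types (f g psi : R -> R) (n m s r : nat).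

Definition bernstein m g (x : R) : R :=
  \sum_(k < m.+1) g (k%:R / m%:R) * ('C(m, k)%:R * x ^+ k * (1 - x) ^+ (m - k)).

(* N n i and c n i stand for n_i(n) and C_i(n); K is the absolute constant
   bounding both n_(s-1)(n) / n and the sum of the |C_i(n)|. *)
Definition comb_data s (K : R) (N : nat -> nat -> nat) (c : nat -> nat -> R) : Prop :=
  forall n, (0 < n)%N ->
    [/\ [/\ N n 0%N = n,
            (forall i, (i.+1 < s)%N -> (N n i < N n i.+1)%N) &
            (N n s.-1)%:R <= K * n%:R],
        \sum_(i < s) `|c n i| <= K,
        \sum_(i < s) c n i = 1 &
        forall k, (0 < k < s)%N -> \sum_(i < s) c n i / (N n i)%:R ^+ k = 0].

Definition bernstein_comb s (N : nat -> nat -> nat) (c : nat -> nat -> R) n g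
    (x : R) : R :=
  \sum_(i < s) c n i * bernstein (N n i) g x.

(* Nodes t 0, ..., t (r-1). *)
Definition lagrange_interp r (t : nat -> R) f (x : R) : R :=
  \sum_(i < r) f (t i) * (tnth (lagrange r t) i : {poly R}).[x].

Definition left_interp r n : (R -> R) -> R -> R :=
  lagrange_interp r (fun i => i.+1%:R / n%:R).

Definition right_interp r n : (R -> R) -> R -> R :=
  lagrange_interp r (fun i => 1 - i.+1%:R / n%:R).

(* For n > 3 and psi a smooth cutoff, adjacent branches agree at the common
   endpoints of their intervals. *)
Definition modif psi r n f (x : R) : R :=
  let L := left_interp r n f x in
  let Q := right_interp r n f x in
  if x <= 1 / n%:R then L
  else if x <= 2 / n%:R then
    (1 - psi (n%:R * x - 1)) * L + psi (n%:R * x - 1) * f x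
  else if x <= 1 - 2 / n%:R then f x
  else if x <= 1 - 1 / n%:R then
    (1 - psi (n%:R * (1 - x) - 1)) * Q + psi (n%:R * (1 - x) - 1) * f x
  else Q.

Definition bernstein_star psi r (N : nat -> nat -> nat) (c : nat -> nat -> R) n f :
    R -> R :=
  bernstein_comb r.-1 N c n (modif psi r n f).

End Operators.

(* Main.v *)
Require Import Defs.
From HB Require Import structures.
From mathcomp Require Import all_boot all_order all_algebra.
From mathcomp Require Import all_classical all_reals all_analysis.
From mathcomp Require Import measurable_realfun ess_sup_inf ring lra zify.

(* The r-th derivative of B_m(F) is m(m-1)...(m-r+1) times the sum over k of
   Delta^r F(k/m) p_{m-r,k}(x), where Delta^r is the forward difference of step
   1/m. On the interval [p,q] spanned by the grid window and its neighbouring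
   nodes, f is within A p^{-a} (1-q)^{-b} (q-p)^r of a polynomial P of degree
   less than r, where a = alpha + r beta(0), b = beta + r beta(1) and A is a
   multiple of ||w phi^r f^(r)||. Near the endpoints F_n is a convex combination
   of f and of its interpolation polynomials, which also stay close to P, so F_n
   is close to P on the whole window; as Delta^r annihilates P, this bounds
   Delta^r F_n(k/m). Since q - p = O(1/n), m <= K n, and p, 1 - q are at least
   of order (k+1)/m, (m-r-k+1)/m, what remains is the classical moment estimate
     sum_k p_{l,k}(x) ((l+1)x/(k+1))^a ((l+1)(1-x)/(l-k+1))^b = O(1).
   The cancellation conditions on the coefficients C_i(n) play no role. *)

Set Implicit Arguments.
Unset Strict Implicit.
Unset Printing Implicit Defensive.

Import Order.TTheory GRing.Theory Num.Theory.
Import numFieldNormedType.Exports.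

Local Open Scope classical_set_scope.
Local Open Scope ring_scope.

(** * Absolutely continuous functions *)

Section AbsoluteContinuity.
Context {R : realType}.
Implicit Types (a b c d e x y S : R) (g u : R -> R).

(** Refining every interval of a family yields a family indexed by dependent pairs, so arbitrary
    finite index types are wanted; [enum_val] transports the property from ordinals. *)
Lemma abs_continuous_finType a b g : abs_continuous a b g ->
  forall e, 0 < e -> exists2 d, 0 < d &
    forall (I : finType) (s : I -> R * R),
      (forall i, [&& a <= (s i).1, (s i).1 <= (s i).2 & (s i).2 <= b]) ->
      (forall i j, i != j ->
         `](s i).1, (s i).2[ `&` `](s j).1, (s j).2[ = set0) ->
      \sum_i ((s i).2 - (s i).1) < d -> \sum_i `|g (s i).2 - g (s i).1| < e.
Proof.
move=> acg e e0; have [d d0 H] := acg e e0; exists d => // I s sab sdisj ssum.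
have e_sum (F : I -> R) : \sum_(i < #|I|) F (enum_val i) = \sum_i F i.
  by rewrite -(big_enum_val (A := I) F); apply: eq_bigl => i.
have := H #|I| (s \o enum_val); rewrite /= (e_sum (fun i => (s i).2 - (s i).1)).
rewrite (e_sum (fun i => `|g (s i).2 - g (s i).1|)); apply => // i j ij.
by apply: sdisj; apply: contra ij => /eqP/enum_val_inj ->.
Qed.

Lemma abs_continuous_sub a b c d g : a <= c -> d <= b ->
  abs_continuous a b g -> abs_continuous c d g.
Proof.
move=> ac db acg e e0; have [t t0 H] := acg e e0; exists t => // m s scd.
apply: H => i; have /and3P[cs -> sd] := scd i.
by rewrite (le_trans ac cs) (le_trans sd db).
Qed.

(** A partition list omits its left endpoint, hence the [c] put in front. *)
Definition itv_pieces c d (l : seq R) (i : nat) : R * R :=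
  (nth d (c :: l) i, nth d (c :: l) i.+1).

Lemma itv_pieces_le c d l i : itv_partition c d l -> (i < size l)%N ->
  [&& c <= (itv_pieces c d l i).1,
      (itv_pieces c d l i).1 <= (itv_pieces c d l i).2
    & (itv_pieces c d l i).2 <= d].
Proof.
move=> cdl il; rewrite (itv_partition_nth_ge _ cdl) ?(ltn_trans il)//.
rewrite (@itv_partition_nth_le _ _ c d l i.+1) ?ltnS// andbT /=.
by have [/(pathP d)/(_ i il)/ltW] := cdl.
Qed.

Lemma itv_pieces_disj c d l i j : itv_partition c d l ->
  (i < size l)%N -> (j < size l)%N -> i != j ->
  `](itv_pieces c d l i).1, (itv_pieces c d l i).2[ `&`
  `](itv_pieces c d l j).1, (itv_pieces c d l j).2[ = set0.
Proof.
move=> cdl.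
wlog ij : i j / (i < j)%N => [hw il jl ij|il jl _].
  move: ij; rewrite neq_ltn => /orP[ij|ji].
    by apply: hw => //; rewrite lt_eqF.
  by rewrite setIC; apply: hw => //; rewrite lt_eqF.
rewrite -subset0 => x /= []; rewrite !in_itv/= => /andP[_ xi] /andP[jx _].
have [srt _] := cdl.
have : nth d (c :: l) i.+1 <= nth d (c :: l) j.
  by rewrite lt_sorted_leq_nth// inE /= ltnS ltnW.
by move=> /(lt_le_trans xi)/lt_trans/(_ jx); rewrite ltxx.
Qed.

Lemma itv_pieces_sum c d l : itv_partition c d l ->
  \sum_(i < size l) ((itv_pieces c d l i).2 - (itv_pieces c d l i).1) = d - c.
Proof.
move=> cdl; rewrite -(big_mkord xpredT
  (fun i => (itv_pieces c d l i).2 - (itv_pieces c d l i).1)).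
rewrite (telescope_sumr (fun i => nth d (c :: l) i))//.
by rewrite (itv_partition_nth_size d cdl).
Qed.

Lemma itv_pieces_variation c d g l :
  \sum_(i < size l) `|g (itv_pieces c d l i).2 - g (itv_pieces c d l i).1|
  = variation c d g l.
Proof. by rewrite /variation big_mkord. Qed.

(** With tolerance 1: the pieces of a partition of an interval shorter than [t] have total length
    below [t], so every variation is at most 1. *)
Lemma abs_continuous_bounded_variation a b g : abs_continuous a b g ->
  exists2 t, 0 < t & forall c d, a <= c -> d <= b -> d - c < t ->
    bounded_variation c d g.
Proof.
move=> acg; have [t t0 H] := abs_continuous_finType acg ltr01.
exists t => // c d ac db dct; exists 1 => _ [l cdl <-].
rewrite -itv_pieces_variation; apply/ltW; apply: (H _ (fun i : 'I_(size l) => _)).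
- move=> i; have /and3P[h1 -> h3] := itv_pieces_le cdl (ltn_ord i).
  by rewrite (le_trans ac h1) (le_trans h3 db).
- by move=> i j ij; exact: itv_pieces_disj.
- by rewrite itv_pieces_sum.
Qed.

Lemma bounded_variation_sub c d x y g : c <= x -> x <= y -> y <= d ->
  bounded_variation c d g -> bounded_variation x y g.
Proof.
move=> cx xy yd; move/(bounded_variationl (le_trans cx xy) yd).
exact: bounded_variationr.
Qed.

(** An infinite variation is sent to 0, so this is meaningful only under bounded variation. *)
Definition var_fun c g (x : R) : R := fine (total_variation c x g).

Lemma var_funB c d g x y : bounded_variation c d g ->
  c <= x -> x <= y -> y <= d ->
  (var_fun c g y - var_fun c g x)%:E = total_variation x y g.
Proof.
move=> bv cx xy yd; have xyfin : total_variation x y g \is a fin_num.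
  by apply/bounded_variationP => //; exact: bounded_variation_sub bv.
have cxfin : total_variation c x g \is a fin_num.
  by apply/bounded_variationP => //; apply: bounded_variation_sub bv => //; exact: le_trans yd.
rewrite /var_fun (total_variationD g cx xy) fineD// addrAC subrr add0r.
by rewrite fineK.
Qed.

Lemma var_fun_ge c d g x y : bounded_variation c d g ->
  c <= x -> x <= y -> y <= d ->
  `|g y - g x| <= var_fun c g y - var_fun c g x.
Proof.
move=> bv cx xy yd; rewrite -lee_fin (var_funB bv)//.
exact: total_variation_ge.
Qed.

(* Each piece of a family is refined by a partition almost realising the total
   variation over it; the refined family has the same total length. *)
Lemma var_fun_abs_continuous c d g : bounded_variation c d g ->
  abs_continuous c d g -> abs_continuous c d (var_fun c g).
Proof.
move=> bv acg e e0; have e20 : 0 < e / 2 by rewrite divr_gt0.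
have [t t0 H] := abs_continuous_finType acg e20.
exists t => // m s scd sdisj ssum.
(* The [m] refinement errors cost at most [e / 2] together; [m.+1] covers the empty family. *)
pose eta := e / 2 / m.+1%:R; have eta0 : 0 < eta by rewrite divr_gt0.
have /choice[l lP] : forall i : 'I_m, exists l : seq R,
    itv_partition (s i).1 (s i).2 l /\
    var_fun c g (s i).2 - var_fun c g (s i).1 <= variation (s i).1 (s i).2 g l + eta.
  move=> i; have /and3P[cs ss sd] := scd i.
  have fin : total_variation (s i).1 (s i).2 g \is a fin_num.
    by apply/bounded_variationP => //; exact: bounded_variation_sub bv.
  have [_ [_ [l sl <-] <-]] := ub_ereal_sup_adherent eta0 fin.
  rewrite -/(total_variation _ _ _) -(var_funB bv)// -EFinB lte_fin => h.
  by exists l; split => //; rewrite -lerBlDr ltW.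
pose J := {i : 'I_m & 'I_(size (l i))}.
pose q (j : J) := itv_pieces (s (tag j)).1 (s (tag j)).2 (l (tag j)) (tagged j).
have qle (j : J) : [&& (s (tag j)).1 <= (q j).1, (q j).1 <= (q j).2
    & (q j).2 <= (s (tag j)).2].
  exact: itv_pieces_le (lP _).1 _.
have sumJ (F : R * R -> R) : \sum_j F (q j) =
    \sum_(i < m) \sum_(k < size (l i)) F (itv_pieces (s i).1 (s i).2 (l i) k).
  by rewrite (sig_big_dep xpredT (fun _ => xpredT)
    (fun i (k : 'I_(size (l i))) => F (itv_pieces (s i).1 (s i).2 (l i) k))).
have : \sum_j `|g (q j).2 - g (q j).1| < e / 2.
  apply: H.
  - move=> j; have /and3P[h1 -> h3] := qle j; have /and3P[h4 _ h5] := scd (tag j).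
    by rewrite (le_trans h4 h1) (le_trans h3 h5).
  - move=> [i k] [i' k'] ij; rewrite /q /=.
    (* Pieces of different intervals are disjoint because the intervals are; pieces of the same
       interval because they come from one partition. *)
    have [ii'|ii'] := eqVneq i i'; last first.
      have /= /and3P[h1 _ h2] := qle (existT _ i k).
      have /= /and3P[h3 _ h4] := qle (existT _ i' k').
      apply/seteqP; split => // x [/=]; rewrite !in_itv/= => /andP[x1 x2] /andP[x3 x4].
      have := sdisj _ _ ii'; rewrite -subset0 => /(_ x); apply; split; rewrite /= in_itv/=.
        by rewrite (le_lt_trans h1 x1) (lt_le_trans x2 h2).
      by rewrite (le_lt_trans h3 x3) (lt_le_trans x4 h4).
    move: k' ij; rewrite -ii' => k' ij; apply: itv_pieces_disj => //.
      exact: (lP _).1.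
    by apply: contra ij => /eqP/val_inj ->.
  - rewrite (sumJ (fun p => p.2 - p.1)).
    by under eq_bigr do rewrite (itv_pieces_sum (lP _).1).
rewrite (sumJ (fun p => `|g p.2 - g p.1|)).
under eq_bigr do rewrite itv_pieces_variation.
move=> Hlt; rewrite [e](splitr e).
apply: (@le_lt_trans _ _ (\sum_(i < m) (variation (s i).1 (s i).2 g (l i) + eta))).
  apply: ler_sum => i _; have /and3P[cs ss sd] := scd i.
  rewrite ger0_norm; first exact: (lP i).2.
  by rewrite (le_trans _ (var_fun_ge bv cs ss sd)).
rewrite big_split/= sumr_const card_ord ltr_leD// /eta -[leLHS]mulr_natr.
rewrite -mulrA ler_piMr ?(ltW e20)// mulrC ler_pdivrMr// mul1r ler_nat.
by [].
Qed.

End AbsoluteContinuity.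

(** * Densities of monotone absolutely continuous functions *)

Section MonotoneDensity.
Context {R : realType}.
Implicit Types (a b c d e x y S : R) (g u : R -> R).
Notation mu := (@lebesgue_measure R).

(** Uniform continuity, from families of a single interval. *)
Lemma abs_continuous_dist c d u : abs_continuous c d u ->
  forall e, 0 < e -> exists2 t, 0 < t &
    forall x y, c <= x <= d -> c <= y <= d -> `|y - x| < t -> `|u y - u x| < e.
Proof.
move=> acu e e0; have [t t0 H] := acu e e0; exists t => // x y.
wlog xy : x y / x <= y => [hw cx cy xyt|].
  have [xy|/ltW yx] := leP x y; first exact: hw.
  by rewrite distrC; apply: hw => //; rewrite distrC.
move=> /andP[cx _] /andP[_ yd] xyt.
have := H 1%N (fun=> (x, y)); rewrite !big_ord1/=; apply.
- by move=> _; rewrite cx xy yd.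
- by move=> i j; rewrite !ord1 eqxx.
- by rewrite -(ger0_norm (_ : 0 <= y - x))// subr_ge0.
Qed.

(** Precomposing with this retraction onto [[c, d]] extends a function by constants to the whole
    line, where cumulative functions must be defined. *)
Definition clamp c d x : R := Num.max c (Num.min x d).

Lemma clamp_bound c d x : c <= d -> c <= clamp c d x <= d.
Proof. by move=> cd; rewrite /clamp le_max lexx/= ge_max cd ge_min lexx orbT. Qed.

Lemma clamp_id c d x : c <= x <= d -> clamp c d x = x.
Proof. by move=> /andP[cx xd]; rewrite /clamp min_l// max_r. Qed.

Lemma clamp_nd c d : {homo clamp c d : x y / x <= y}.
Proof.
move=> x y xy; rewrite /clamp ge_max !le_max lexx/= le_min !ge_min xy/= lexx.
by rewrite !orbT.
Qed.

Lemma clamp_dist c d x y : c <= d -> `|clamp c d x - clamp c d y| <= `|x - y|.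
Proof.
move=> cd; wlog xy : x y / x <= y => [hw|].
  have [xy|/ltW yx] := leP x y; first exact: hw.
  by rewrite distrC [leRHS]distrC; exact: hw.
rewrite distrC [leRHS]distrC !ger0_norm ?subr_ge0 ?clamp_nd//.
rewrite /clamp !maxElt !minElt.
by case: (ltP x d); case: (ltP y d) => ? ?; case: ltP => ?; case: ltP => ?; lra.
Qed.

(* The Lebesgue-Stieltjes measure of u is dominated by the Lebesgue measure, and
   its Radon-Nikodym derivative is almost everywhere the derivative of u. *)
Section cumulative_of_abs_continuous.
Variables (c d : R) (u : R -> R).
Hypotheses (cd : c < d) (und : {in `[c, d] &, nondecreasing_fun u})
  (acu : abs_continuous c d u).

Let U x := u (clamp c d x).

Let U_nd : nondecreasing U.
Proof.
have cd' := ltW cd.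
by move=> x y xy; apply: und; rewrite ?in_itv/= ?clamp_bound ?clamp_nd.
Qed.

Let U_rc : forall x, U @ x^'+ --> U x.
Proof.
apply: right_continuousW => x; apply/cvgrPdist_lt => e e0.
have [t t0 H] := abs_continuous_dist acu e0.
have cd' := ltW cd; near=> y; apply: H; rewrite ?clamp_bound//.
by rewrite (le_lt_trans (clamp_dist _ _ cd'))//; near: y; exact: cvgr_dist_lt.
Unshelve. all: by end_near. Qed.

Let F : cumulative R R := HB.pack U (isCumulative.Build R _ R U U_nd U_rc).
Let nu := lebesgue_stieltjes_measure F.

Let nu_oc x y : c <= x -> x <= y -> y <= d -> nu `]x, y]%classic = (u y - u x)%:E.
Proof.
move=> cx xy yd; rewrite /nu /lebesgue_stieltjes_measure /measure_extension.
rewrite measurable_mu_extE/=; last exact: is_ocitv.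
rewrite wlength_itv_bnd//= /U !clamp_id ?cx ?yd ?(le_trans xy)//.
by rewrite (le_trans cx).
Qed.

Let mD : measurable (`]c, d[%classic : set (measurableTypeR R)). Proof. exact: measurable_itv. Qed.

Let nu_oo x y : c <= x -> x <= y -> y <= d ->
  (nu `]x, y[%classic <= (u y - u x)%:E)%E.
Proof.
move=> cx xy yd; rewrite -nu_oc//; apply: le_measure; rewrite ?inE//.
by move=> z /=; rewrite !in_itv/= => /andP[-> /ltW].
Qed.

Let nuDoo : (nu `]c, d[%classic < +oo)%E.
Proof. by rewrite (le_lt_trans (nu_oo _ (ltW cd) _)) ?ltry. Qed.

Let nuD := mfrestr mD nuDoo.

(** A null set lies in open sets of arbitrarily small measure. The part of such a set inside []c,
    d[] is a countable disjoint union of open intervals; any finitely many of them have total length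
    below [t], so [u] grows over them by less than [e], and the bound passes to the limit. *)
Let nuD_null : nuD `<< mu.
Proof.
apply/null_content_dominatesP => N mN N0; apply/eqP.
rewrite eq_le measure_ge0 andbT; apply/lee_addgt0Pr => e e0; rewrite add0e.
have [t t0 H] := acu e0.
have t20 : 0 < t / 2 by rewrite divr_gt0.
have [G [oG NG Gt]] := outer_measure_open_le N t20.
have Ot2 : (mu (G `&` `]c, d[%classic) < t%:E)%E.
  apply: (@le_lt_trans _ _ (mu G)).
    apply: le_measure; rewrite ?inE; [|exact: open_measurable|exact: subIsetl].
    by apply: measurableI; [exact: open_measurable|exact: measurable_itv].
  apply: le_lt_trans Gt _; rewrite -[X in (X + _)%E]/(mu N) N0 add0e lte_fin.
  by rewrite ltr_pdivrMr// ltr_pMr// ltr1n.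
have oI : open (G `&` `]c, d[%classic) by apply: openI => //; exact: interval_open.
pose J := open_disjoint_itv oI.
have JcdE k : J k `<=` `]c, d[%classic.
  move=> x Jkx; have : (G `&` `]c, d[%classic) x.
    by rewrite (open_disjoint_itv_bigcup oI); exists k.
  by case.
have JE k : J k !=set0 -> J k = `]inf (J k), sup (J k)[%classic.
  move=> J0; rewrite -interval_bounded_interior.
  - by apply/esym/interior_id; exact: open_disjoint_itv_open.
  - exact: open_disjoint_itv_is_interval.
  - by exists c => x /JcdE /=; rewrite in_itv/= => /andP[/ltW].
  - by exists d => x /JcdE /=; rewrite in_itv/= => /andP[_ /ltW].
(* The endpoints of each component; an empty one is coded by [(c, c)]. *)
have /choice[s sP] : forall k, exists s : R * R,
    [/\ c <= s.1, s.1 <= s.2, s.2 <= d & J k = `]s.1, s.2[%classic].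
  move=> k; have [J0|/set0P/negP/negPn/eqP J0] := pselect (J k !=set0); last first.
    exists (c, c); rewrite J0/= set_itv_ge ?bnd_simp ?ltxx//.
    by split => //; exact: ltW.
  exists (inf (J k), sup (J k)); rewrite /= -JE//.
  have [z Jz] := J0.
  have hs : has_sup (J k).
    by split => //; exists d => x /JcdE /=; rewrite in_itv/= => /andP[_ /ltW].
  have hi : has_inf (J k).
    by split => //; exists c => x /JcdE /=; rewrite in_itv/= => /andP[/ltW].
  split => //.
  - by apply: lb_le_inf => // x /JcdE /=; rewrite in_itv/= => /andP[/ltW].
  - by rewrite (le_trans (ge_inf hi.2 Jz))// ub_le_sup//; exact: hs.2.
  - by apply: ge_sup => // x /JcdE /=; rewrite in_itv/= => /andP[_ /ltW].
have mJ k : measurable (J k) by case: (sP k) => _ _ _ ->; exact: measurable_itv.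
have Jdisj : trivIset setT J by exact: open_disjoint_itv_trivIset.
have sumJ (m : {measure set (measurableTypeR R) -> \bar R}) :
    m (\bigcup_k J k) = (\sum_(k <oo) m (J k))%E.
  apply/esym/cvg_lim => //; apply: measure_semi_sigma_additive => //.
  by apply: (@bigcup_measurable _ (measurableTypeR R)) => k _; exact: mJ.
have Jsum n : \sum_(k < n) ((s k).2 - (s k).1) < t.
  rewrite -lte_fin; apply: le_lt_trans Ot2.
  rewrite (open_disjoint_itv_bigcup oI) -/J.
  have -> : (\sum_(k < n) ((s k).2 - (s k).1))%:E = (\sum_(k < n) mu (J k))%E.
    rewrite -sumEFin; apply: eq_bigr => k _; case: (sP k) => _ s12 _ ->.
    rewrite lebesgue_measure_itv/= lte_fin; case: ltgtP s12 => // -> _.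
    by rewrite subrr.
  rewrite [leRHS](sumJ mu) -(big_mkord xpredT (fun k => mu (J k))); exact: nneseries_lim_ge.
have : (nuD N <= \sum_(k <oo) nu (J k))%E.
  rewrite -[leRHS](sumJ nu); apply: le_measure; rewrite ?inE//.
  - exact: measurableI.
  - by apply: (@bigcup_measurable _ (measurableTypeR R)) => k _; exact: mJ.
  - by rewrite -(open_disjoint_itv_bigcup oI); exact: setSI.
move=> /le_trans; apply; apply: lime_le; first exact: is_cvg_nneseries.
apply: nearW => n; rewrite big_mkord.
apply: (@le_trans _ _ (\sum_(k < n) (u (s k).2 - u (s k).1)%:E)%E).
  by apply: lee_sum => k _; case: (sP k) => ? ? ? ->; exact: nu_oo.
rewrite sumEFin lee_fin; apply: (le_trans (ler_norm _)).
apply: (le_trans (ler_norm_sum _ _ _)); apply/ltW.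
apply: (H _ (fun k : 'I_n => s k)) => // [k|i j ij].
  by case: (sP k) => -> -> ->.
case: (sP i) => _ _ _ <-; case: (sP j) => _ _ _ <-.
by have /trivIsetP/(_ i j Logic.I Logic.I) := Jdisj; exact.
Qed.

Lemma nondecreasing_abs_continuous_density : exists h : R -> R,
  [/\ mu.-integrable [set: R] (EFin \o h),
      forall x, c < x < d -> u x - u c = \int[mu]_(t in `]c, x]) h t &
      {ae mu, forall x, c < x < d -> is_derive x 1 u (h x)}].
Proof.
pose k := Radon_Nikodym_SigmaFinite.f nuD mu.
have kfin := Radon_Nikodym_SigmaFinite.f_fin_num nuD_null.
have kint := Radon_Nikodym_SigmaFinite.f_integrable nuD_null.
have kE := Radon_Nikodym_SigmaFinite.f_integral nuD_null.
pose h x := fine (k x).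
have hk : EFin \o h = k by apply/funext => x /=; rewrite /h fineK// kfin.
have hint : mu.-integrable [set: R] (EFin \o h) by rewrite hk.
have uE x : c < x < d -> u x - u c = \int[mu]_(t in `]c, x]) h t.
  move=> /andP[cx xd]; rewrite /Rintegral.
  have -> : (\int[mu]_(t in `]c, x]) (h t)%:E = nuD `]c, x]%classic)%E.
    transitivity (\int[mu]_(t in `]c, x]) k t)%E; first by rewrite -hk.
    by apply/esym/kE; exact: measurable_itv.
  rewrite /nuD /mfrestr /mrestr setIidl; last first.
    by move=> z /=; rewrite !in_itv/= => /andP[-> /le_lt_trans]; exact.
  by rewrite nu_oc//; exact: ltW.
exists h; split => //.
have hloc : locally_integrable [set: R] h.
  by apply: open_integrable_locally => //; exact: openT.
have hitv y : mu.-integrable `]c, y] (EFin \o h).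
  by apply: integrableS hint => //; exact: measurable_itv.
(* The integral [G] of [h] from [c] has derivative [h] almost everywhere, and [u] agrees with
   [G + u c] near every point of []c, d[]. *)
have := @FTC1 R h (BRight c) hitv hloc.
apply: filterS; first exact: (ae_filter_ringOfSetsType mu).
move=> x /= FT /andP[cx xd]; have [dF F'] := FT cx.
set G := (fun y : R => _) in dF F'.
have Gd : is_derive x 1 (G \+ cst (u c)) (h x).
  rewrite -[h x]addr0; apply: is_deriveD.
  by apply: DeriveDef => //; rewrite -derive1E.
apply: near_eq_is_derive Gd; near=> y.
rewrite -[RHS](subrK (u c)); congr (_ + _); apply/esym/uE.
by apply/andP; split; near: y; [exact: lt_nbhsr|exact: lt_nbhsl].
Unshelve. all: by end_near. Qed.

End cumulative_of_abs_continuous.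
End MonotoneDensity.

(** * From almost everywhere derivative bounds to Lipschitz bounds *)

Section LipschitzBound.
Context {R : realType}.
Implicit Types (a b c d e x y S : R) (g u : R -> R).
Notation mu := (@lebesgue_measure R).

Lemma abs_continuousB c d g u : abs_continuous c d g -> abs_continuous c d u ->
  abs_continuous c d (g \- u).
Proof.
move=> acg acu e e0; have e20 : 0 < e / 2 by rewrite divr_gt0.
have [t t0 H] := acg _ e20; have [t' t'0 H'] := acu _ e20.
exists (Num.min t t'); first by rewrite lt_min t0.
move=> m s sb sdisj; rewrite lt_min => /andP[st st'].
rewrite [e]splitr; apply: le_lt_trans (ltrD (H m s sb sdisj st) (H' m s sb sdisj st')).
rewrite -big_split/=; apply: ler_sum => i _.
rewrite (_ : _ - _ - _ = (g (s i).2 - g (s i).1) - (u (s i).2 - u (s i).1)); last by ring.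
exact: ler_normB.
Qed.

(** Jordan decomposition: the variation function [V] and [V - g] are nondecreasing and absolutely
    continuous, so their increments are integrals of densities [h1] and [h2]. Increments of [g] are
    then integrals of [h1 - h2], which equals the derivative of [g] almost everywhere and is bounded
    by [S]. *)
Lemma bounded_variation_lipschitz c d g S : c < d -> 0 <= S -> abs_continuous c d g ->
  bounded_variation c d g ->
  {ae mu, forall x, c < x < d -> `|derive1 g x| <= S} ->
  forall x y, c < x -> x <= y -> y < d -> `|g y - g x| <= S * (y - x).
Proof.
move=> cd S0 acg bv gS x y cx xy yd.
have acV := var_fun_abs_continuous bv acg; set V := var_fun c g in acV.
have Vge s t : c <= s -> s <= t -> t <= d -> `|g t - g s| <= V t - V s.
  exact: var_fun_ge.
have Vnd : {in `[c, d] &, nondecreasing_fun V}.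
  move=> s t; rewrite !in_itv/= => /andP[cs _] /andP[_ td] st.
  by rewrite -subr_ge0 (le_trans _ (Vge _ _ cs st td)).
have Wnd : {in `[c, d] &, nondecreasing_fun (V \- g)}.
  move=> s t; rewrite !in_itv/= => /andP[cs _] /andP[_ td] st.
  have := Vge _ _ cs st td; have := ler_norm (g t - g s); lra.
have [h1 [h1int h1E h1d]] := nondecreasing_abs_continuous_density cd Vnd acV.
have [h2 [h2int h2E h2d]] :=
  nondecreasing_abs_continuous_density cd Wnd (abs_continuousB acV acg).
pose h t := h1 t - h2 t.
have hint : mu.-integrable [set: R] (EFin \o h).
  have -> : EFin \o h = ((EFin \o h1) \- (EFin \o h2))%E by apply/funext.
  exact: integrableB.
have hS : {ae mu, forall t, c < t < d -> `|h t| <= S}.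
  move: gS h1d h2d; apply: filterS3; first exact: (ae_filter_ringOfSetsType mu).
  move=> t gS h1d h2d ctd.
  have dg : is_derive t 1 g (h t).
    have -> : g = V \- (V \- g) by apply/funext => z /=; lra.
    by apply: is_deriveB; [exact: h1d|exact: h2d].
  by have := gS ctd; rewrite derive1E derive_val.
have hitv D : measurable D -> mu.-integrable D (EFin \o h).
  by move=> mDD; exact: integrableS hint.
have cxd : c < x < d by rewrite cx (le_lt_trans xy yd).
have cyd : c < y < d by rewrite yd (lt_le_trans cx xy).
have incr (u k : R -> R) : mu.-integrable [set: R] (EFin \o k) ->
    (forall x, c < x < d -> u x - u c = \int[mu]_(t in `]c, x]) k t) ->
    u y - u x = \int[mu]_(t in `]x, y]) k t.
  move=> kint kE; have -> : u y - u x = (u y - u c) - (u x - u c) by ring.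
  rewrite (kE _ cyd) (kE _ cxd); apply: (@Rintegral_itvB _ k (BRight c) (BRight y) x).
  - by apply: integrableS kint => //; exact: measurable_itv.
  - by rewrite bnd_simp ltW.
  - by rewrite bnd_simp.
have mxy : measurable (`]x, y]%classic : set (measurableTypeR R)).
  exact: measurable_itv.
have -> : g y - g x = \int[mu]_(t in `]x, y]) h t.
  have -> : g y - g x = (V y - V x) - ((V \- g) y - (V \- g) x) by rewrite /=; ring.
  rewrite (incr _ _ h1int h1E) (incr _ _ h2int h2E) -RintegralB//.
  - by apply: integrableS h1int.
  - by apply: integrableS h2int.
apply: le_trans (le_normr_Rintegral mxy (hitv _ mxy)) _.
rewrite -lee_fin /Rintegral fineK; last first.
  apply: integrable_fin_num => //; exact: (integrable_norm (hitv _ _)).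
have -> : (S * (y - x))%:E = (\int[mu]_(t in `]x, y]) (cst S%:E t))%E.
  rewrite integral_cst// [X in (_ * X)%E]lebesgue_measure_itv/= lte_fin.
  by case: ltgtP xy => // -> _; rewrite subrr mulr0 mule0.
apply: ae_ge0_le_integral => //.
- apply/measurable_EFinP/measurableT_comp => //.
  by have /measurable_int/measurable_EFinP := hitv _ mxy.
- move: hS; apply: filterS; first exact: (ae_filter_ringOfSetsType mu).
  move=> t H; rewrite /= in_itv/= => /andP[xt ty]; rewrite lee_fin; apply: H.
  by rewrite (lt_trans cx xt) (le_lt_trans ty yd).
Qed.

(* [derive1] is 0 at points where g is not derivable, so the hypothesis says
   something there only once g is known to be derivable almost everywhere. *)
Lemma abs_continuous_lipschitz c d g S : 0 <= S -> abs_continuous c d g ->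
  {ae mu, forall x, c < x < d -> `|derive1 g x| <= S} ->
  forall x y, c < x -> x <= y -> y < d -> `|g y - g x| <= S * (y - x).
Proof.
move=> S0 acg gS.
have [t t0 bv] := abs_continuous_bounded_variation acg.
have loc x y : c < x -> x <= y -> y < d -> y - x < t / 2 ->
    `|g y - g x| <= S * (y - x).
  move=> cx xy yd yxt.
  (* The margins put [x] and [y] strictly inside while keeping [d' - c'] below [t], where the
     variation is bounded. *)
  pose c' := Num.max c (x - t / 4); pose d' := Num.min d (y + t / 4).
  have [cc' c'x c't] : [/\ c <= c', c' < x & x - t / 4 <= c'].
    by rewrite /c' le_max lexx gt_max cx le_max lexx orbT; split => //; lra.
  have [dd' d'x d't] : [/\ d' <= d, y < d' & d' <= y + t / 4].
    by rewrite /d' ge_min lexx lt_min yd ge_min lexx orbT; split => //; lra.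
  apply: (@bounded_variation_lipschitz c' d') => //.
  - lra.
  - exact: abs_continuous_sub acg.
  - by apply: bv => //; lra.
  - apply: filterS gS; first exact: (ae_filter_ringOfSetsType mu).
    move=> z H /andP[z1 z2]; apply: H.
    by rewrite (le_lt_trans cc' z1) (lt_le_trans z2 dd').
(* Chaining over [n] equal parts, each shorter than [t / 2]; the induction splits off the last
   one. *)
have main n : forall x y, c < x -> x <= y -> y < d -> y - x < t / 2 * n%:R ->
    `|g y - g x| <= S * (y - x).
  elim: n => [|n ih] x y cx xy yd; first by rewrite mulr0 => ?; exfalso; lra.
  have [->|n0] := posnP n; first by rewrite mulr1; exact: loc.
  move=> yxn; pose z := x + (y - x) * (n%:R / n.+1%:R).
  have q0 : 0 <= (n%:R / n.+1%:R : R) by rewrite divr_ge0.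
  have q1 : (n%:R / n.+1%:R : R) <= 1 by rewrite ler_pdivrMr// mul1r ler_nat.
  have xz : x <= z by rewrite /z lerDl mulr_ge0// subr_ge0.
  have zy : z <= y by rewrite /z -lerBrDl ler_piMr// subr_ge0.
  have -> : g y - g x = (g y - g z) + (g z - g x) by ring.
  rewrite (le_trans (ler_normD _ _))// [leRHS](_ : _ = S * (y - z) + S * (z - x)); last by ring.
  apply: lerD.
    apply: loc => //; first exact: lt_le_trans xz.
    have -> : y - z = (y - x) / n.+1%:R.
      by rewrite /z; field; rewrite ?natr1 ?nat1r pnatr_eq0.
    by rewrite ltr_pdivrMr.
  apply: ih => //; first exact: le_lt_trans yd.
  have -> : z - x = (y - x) / n.+1%:R * n%:R by rewrite /z; field; rewrite ?natr1 ?nat1r pnatr_eq0.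
  by rewrite ltr_pM2r ?ltr0n// ltr_pdivrMr.
move=> x y cx xy yd; apply: (main (Num.bound ((y - x) / (t / 2)))) => //.
rewrite mulrC -ltr_pdivrMr ?divr_gt0//; apply: archi_boundP.
by rewrite !divr_ge0 ?subr_ge0// ltW.
Qed.

End LipschitzBound.

(** * Approximation by polynomials *)

Section PolynomialApproximation.
Context {R : realType}.
Implicit Types (p q S : R) (f : R -> R) (P Q : {poly R}).

Lemma antiderivative_poly P : exists2 Q : {poly R}, deriv Q = P & (size Q <= (size P).+1)%N.
Proof.
exists (\poly_(i < (size P).+1) (P`_i.-1 / i%:R)); last exact: size_poly.
apply/polyP => i; rewrite coef_deriv coef_poly ltnS.
case: ltnP => iP; last by rewrite mul0rn nth_default.
by rewrite -[_ *+ _]mulr_natr divfK// pnatr_eq0.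
Qed.

(* If P approximates f', then the antiderivative of P matching f at p
   approximates f by the mean value theorem. *)
Lemma polynomial_approximation k f p q S : 0 <= S -> p <= q ->
  (forall i, (i < k)%N -> {in `[p, q], forall x, derivable (derive1n i f) x 1}) ->
  (forall x y, p <= x -> x <= y -> y <= q ->
    `|derive1n k f y - derive1n k f x| <= S * (y - x)) ->
  exists2 P : {poly R}, (size P <= k.+1)%N &
    forall x, p <= x <= q -> `|f x - P.[x]| <= S * (q - p) ^+ k.+1.
Proof.
move=> S0 pq; elim: k f => [|k ih] f df lf.
  exists (f p)%:P; first by rewrite size_polyC; case: (_ != 0).
  move=> x /andP[px xq]; rewrite hornerC expr1.
  by rewrite (le_trans (lf _ _ _ px xq))// ler_wpM2l// lerD2r.
have [|x y px xy yq|P sP fP] := ih (derive1 f).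
- by move=> i ik; rewrite -derive1Sn; exact: df.
- by rewrite -derive1Sn; exact: lf.
have [Q dQ sQ] := antiderivative_poly P.
exists (Q + (f p - Q.[p])%:P).
  rewrite (leq_trans (size_polyD _ _))// geq_max (leq_trans sQ)//=.
  by rewrite (leq_trans (size_polyC_leq1 _)).
move=> x /andP[px xq]; rewrite hornerD hornerC.
pose g : R -> R := f \- horner Q.
have dg z : p <= z <= q -> is_derive z 1 g (derive1 f z - P.[z]).
  move=> pzq; apply: is_deriveB; last by rewrite -dQ; exact: is_derive_poly.
  by apply: DeriveDef; [exact: (df 0%N isT _ pzq)|rewrite derive1E].
have dgx z : z \in `[p, x] -> is_derive z 1 g (derive1 f z - P.[z]).
  by rewrite in_itv/= => /andP[pz zx]; apply: dg; rewrite pz (le_trans zx).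
have cg : {within `[p, x], continuous g}.
  by apply: derivable_within_continuous => z /dgx [].
have dgo z : z \in `]p, x[ -> is_derive z 1 g (derive1 f z - P.[z]).
  by move=> zpx; apply: dgx; exact: subset_itv_oo_cc zpx.
have [z zpx gE] := MVT_segment px dgo cg.
have -> : f x - (Q.[x] + (f p - Q.[p])) = g x - g p by rewrite /g/=; ring.
rewrite gE normrM exprS mulrCA [leRHS]mulrC.
have /andP[pz zx] : p <= z <= x by move: zpx; rewrite in_itv.
apply: ler_pM => //; first by apply: fP; rewrite pz (le_trans zx).
by rewrite ger0_norm ?subr_ge0// lerD2r.
Qed.

End PolynomialApproximation.

(** * Bernstein polynomials *)

Section BernsteinMoments.
Context {R : realType}.

(** Each increment of [A] trades a factor [l.+1] for [A.+1 * k.+1], by the absorption identity for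
    binomial coefficients and [k + A + 1 <= A.+1 * k.+1]. *)
Lemma leq_bin_expn l k A :
  ('C(l, k) * l.+1 ^ A <= A`! * 'C(l + A, k + A) * k.+1 ^ A)%N.
Proof.
elim: A => [|A ih]; first by rewrite !expn0 !muln1 !addn0 fact0 mul1n.
rewrite expnSr mulnA (leq_trans (leq_mul ih (leqnn _)))//.
have H : (l.+1 * 'C(l + A, k + A) <= A.+1 * k.+1 * 'C(l + A.+1, k + A.+1))%N.
  rewrite !addnS (@leq_trans ((l + A).+1 * 'C(l + A, k + A)))//.
    by rewrite leq_mul// ltnS leq_addr.
  by have /= -> := mul_bin_diag (l + A).+1 (k + A); rewrite leq_mul//; nia.
rewrite factS expnSr.
rewrite (_ : A`! * _ * _ * _ = A`! * k.+1 ^ A * (l.+1 * 'C(l + A, k + A)))%N; last by ring.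
rewrite (_ : A.+1 * _ * _ * _ =
  A`! * k.+1 ^ A * (A.+1 * k.+1 * 'C(l + A.+1, k + A.+1)))%N; last by ring.
by rewrite leq_mul.
Qed.

(** The one-sided bound is used twice: for [k], then in degree [l + A] for the complementary index
    [l - k], through the symmetry of binomial coefficients. *)
Lemma leq_bin_expn2 l k A B : (k <= l)%N ->
  ('C(l, k) * l.+1 ^ A * l.+1 ^ B <=
   A`! * B`! * 'C(l + A + B, k + A) * k.+1 ^ A * (l - k).+1 ^ B)%N.
Proof.
move=> kl.
have h1 := leq_bin_expn l k A; have h2 := leq_bin_expn (l + A) (l - k) B.
rewrite (leq_trans (leq_mul h1 (leqnn _)))//.
have e1 : 'C(l + A, l - k) = 'C(l + A, k + A).
  by rewrite -bin_sub; [congr 'C(_, _); lia|lia].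
have e2 : 'C(l + A + B, l - k + B) = 'C(l + A + B, k + A).
  by rewrite -bin_sub; [congr 'C(_, _); lia|lia].
rewrite e1 e2 in h2.
have h3 : ('C(l + A, k + A) * l.+1 ^ B <= B`! * 'C(l + A + B, k + A) * (l - k).+1 ^ B)%N.
  by rewrite (leq_trans _ h2)// leq_mul//; case: (B) => // b; rewrite leq_exp2r// ltnS leq_addr.
rewrite (_ : A`! * _ * _ * _ = A`! * k.+1 ^ A * ('C(l + A, k + A) * l.+1 ^ B))%N; last by ring.
rewrite (_ : A`! * B`! * _ * _ * _ =
  A`! * k.+1 ^ A * (B`! * 'C(l + A + B, k + A) * (l - k).+1 ^ B))%N; last by ring.
by rewrite leq_mul.
Qed.

Definition bern (l k : nat) (x : R) : R := 'C(l, k)%:R * x ^+ k * (1 - x) ^+ (l - k).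

Lemma bern_ge0 l k x : 0 <= x <= 1 -> 0 <= bern l k x.
Proof. by move=> /andP[x0 x1]; rewrite /bern !mulr_ge0 ?exprn_ge0 ?subr_ge0. Qed.

Lemma sum_bern l x : \sum_(0 <= k < l.+1) bern l k x = 1.
Proof.
rewrite big_mkord -[RHS](expr1n _ l) -[in RHS](subrK x 1) exprDn.
by apply: eq_bigr => k _; rewrite /bern -mulr_natl; ring.
Qed.

(** The inverse powers are absorbed into the binomial coefficient: each term is at most [A]! * B[!]
    times the basis polynomial of degree [l + A + B] and index [k + A], and basis polynomials of one
    degree are nonnegative with sum 1. *)
Lemma bern_moment l A B x : 0 <= x <= 1 ->
  \sum_(k < l.+1) bern l k x * (l.+1%:R * x / k.+1%:R) ^+ A *
     (l.+1%:R * (1 - x) / (l - k).+1%:R) ^+ B <= A`!%:R * B`!%:R.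
Proof.
move=> x01; have /andP[x0 x1] := x01.
have step (k : 'I_l.+1) : bern l k x * (l.+1%:R * x / k.+1%:R) ^+ A *
     (l.+1%:R * (1 - x) / (l - k).+1%:R) ^+ B <=
     A`!%:R * B`!%:R * bern (l + A + B) (k + A) x.
  have kl : (k <= l)%N by rewrite -ltnS.
  rewrite /bern (_ : (l + A + B - (k + A) = l - k + B)%N); last by lia.
  rewrite !exprMn !exprVn !exprD -!mulrA.
  have k0 : 0 < (k.+1%:R ^+ A : R) by rewrite exprn_gt0.
  have lk0 : 0 < ((l - k).+1%:R ^+ B : R) by rewrite exprn_gt0.
  have := leq_bin_expn2 A B kl; rewrite -(ler_nat R) !natrM !natrX => h.
  rewrite -subr_ge0.
  rewrite (_ : _ - _ = (A`!%:R * B`!%:R * 'C(l + A + B, k + A)%:R *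
      k.+1%:R ^+ A * (l - k).+1%:R ^+ B
     - 'C(l, k)%:R * l.+1%:R ^+ A * l.+1%:R ^+ B) / (k.+1%:R ^+ A * (l - k).+1%:R ^+ B) *
     (x ^+ k * x ^+ A * (1 - x) ^+ (l - k) * (1 - x) ^+ B)); last first.
    by field; rewrite !gt_eqF.
  by rewrite !mulr_ge0 ?exprn_ge0 ?invr_ge0 ?mulr_ge0 ?subr_ge0 ?(ltW k0) ?(ltW lk0).
rewrite (le_trans (ler_sum _ (fun k _ => step k)))// -mulr_sumr ler_piMr ?mulr_ge0//.
set n := (l + A + B)%N.
have -> : \sum_(k < l.+1) bern n (k + A) x = \sum_(A <= k < l.+1 + A) bern n k x.
  have := big_addn 0 (l.+1 + A) A xpredT (fun k => bern n k x) (op := +%R) (idx := 0).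
  by rewrite add0n addnK big_mkord => ->.
rewrite -(sum_bern n x) (@big_cat_nat _ _ _ A 0 n.+1)//=; last by rewrite /n; lia.
rewrite (@big_cat_nat _ _ _ (l.+1 + A) A n.+1)//=; [|lia|by rewrite /n; lia].
by rewrite addrCA lerDl addr_ge0// sumr_ge0// => k _; rewrite bern_ge0.
Qed.

(** Reduces real exponents to the integer ones of [bern_moment]. *)
Lemma powR_le1D (t a : R) A : 0 <= t -> 0 <= a -> a <= A%:R -> t `^ a <= 1 + t ^+ A.
Proof.
move=> t0 a0 aA; have [t1|/ltW t1] := leP t 1.
  rewrite (@le_trans _ _ 1) ?lerDl ?exprn_ge0//.
  have -> : 1 = 1 `^ a :> R by rewrite powR1.
  by apply: ge0_ler_powR; rewrite ?nnegrE.
by rewrite -powR_mulrn// (le_trans (ler_powR t1 aA))// lerDr.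
Qed.

(** After [powR_le1D], multiplying out leaves four moments with integer exponents, each bounded
    uniformly in [l] and [x]. *)
Lemma bern_powR_sum (a b kappa : R) : 0 <= a -> 0 <= b -> 0 <= kappa ->
  exists2 C : R, 0 < C & forall l x, 0 <= x <= 1 ->
  \sum_(k < l.+1) bern l k x * (kappa * (l.+1%:R * x / k.+1%:R)) `^ a *
     (kappa * (l.+1%:R * (1 - x) / (l - k).+1%:R)) `^ b <= C.
Proof.
move=> a0 b0 kap0.
pose A := Num.bound a; pose B := Num.bound b.
have aA : a <= A%:R by exact/ltW/archi_boundP.
have bB : b <= B%:R by exact/ltW/archi_boundP.
exists (1 + kappa ^+ A * A`!%:R + kappa ^+ B * B`!%:R +
  kappa ^+ A * kappa ^+ B * (A`!%:R * B`!%:R)).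
  by rewrite -!addrA ltr_pwDl// !addr_ge0 ?mulr_ge0 ?exprn_ge0.
move=> l x x01; have /andP[x0 x1] := x01.
pose t k : R := l.+1%:R * x / k.+1%:R.
pose s k : R := l.+1%:R * (1 - x) / (l - k).+1%:R.
have t0 k : 0 <= t k by rewrite !mulr_ge0 ?invr_ge0.
have s0 k : 0 <= s k by rewrite !mulr_ge0 ?invr_ge0 ?subr_ge0.
apply: (@le_trans _ _ (\sum_(k < l.+1) (bern l k x * t k ^+ 0 * s k ^+ 0 +
   kappa ^+ A * (bern l k x * t k ^+ A * s k ^+ 0) +
   kappa ^+ B * (bern l k x * t k ^+ 0 * s k ^+ B) +
   kappa ^+ A * kappa ^+ B * (bern l k x * t k ^+ A * s k ^+ B)))).
  apply: ler_sum => k _; rewrite -mulrA.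
  rewrite [leRHS](_ : _ =
    bern l k x * ((1 + (kappa * t k) ^+ A) * (1 + (kappa * s k) ^+ B))); last first.
    by rewrite !exprMn !expr0; ring.
  rewrite ler_wpM2l ?bern_ge0// ler_pM ?powR_ge0//; apply: powR_le1D => //.
  - by rewrite mulr_ge0 ?t0.
  - by rewrite mulr_ge0 ?s0.
rewrite !big_split/= -!mulr_sumr !lerD ?ler_wpM2l ?mulr_ge0 ?exprn_ge0//.
- by have := bern_moment l 0 0 x01; rewrite !fact0 mulr1.
- by have := bern_moment l A 0 x01; rewrite fact0 mulr1.
- by have := bern_moment l 0 B x01; rewrite fact0 mul1r.
- exact: bern_moment.
Qed.

End BernsteinMoments.

(** * Derivatives of Bernstein polynomials through finite differences *)

Section BernsteinDerivative.
Context {R : realType}.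
Implicit Types (a b : nat -> R) (P Q : {poly R}).

Definition fdiff a (k : nat) : R := a k.+1 - a k.

Lemma iter_fdiff_le r a k e :
  (forall j, (k <= j <= k + r)%N -> `|a j| <= e) -> `|iter r fdiff a k| <= 2 ^+ r * e.
Proof.
elim: r k => [|r ih] k ae; first by rewrite mul1r; apply: ae; rewrite addn0 leqnn.
rewrite iterS /fdiff (le_trans (ler_normB _ _))// exprS -mulrA mulr_natl mulr2n.
by rewrite lerD// ih// => j /andP[kj jk]; apply: ae; lia.
Qed.

Lemma iter_fdiffB r a b k :
  iter r fdiff (fun j => a j - b j) k = iter r fdiff a k - iter r fdiff b k.
Proof. by elim: r k => [//|r ih] k; rewrite !iterS /fdiff !ih; ring. Qed.

(** Substituting the monic ['X + h%:P] preserves size and leading coefficient, so the leading terms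
    cancel. *)
Lemma size_poly_shiftB P (h : R) : (size (P \Po ('X + h%:P) - P)%R <= (size P).-1)%N.
Proof.
have [->|P0] := eqVneq P 0; first by rewrite comp_poly0 subr0 size_poly0.
have sX : size ('X + h%:P) = 2%N by rewrite size_XaddC.
have sc : size (P \Po ('X + h%:P)) = size P by rewrite size_comp_poly2.
apply/leq_sizeP => i; rewrite leq_eqVlt => /predU1P[<-|Pi].
  rewrite coefB -{1}sc -!lead_coefE lead_coef_comp ?sX//.
  by rewrite lead_coefXaddC expr1n mulr1 subrr.
have sPi : (size P <= i)%N by case: (size P) Pi.
by rewrite coefB !nth_default ?sc ?subrr.
Qed.

Lemma iter_fdiff_poly r P (h : R) k : (size P <= r)%N ->
  iter r fdiff (fun j => P.[j%:R * h]) k = 0.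
Proof.
elim: r P => [|r ih] P sP.
  by move: sP; rewrite leqn0 size_poly_eq0 => /eqP ->; rewrite /= horner0.
rewrite iterSr -(ih (P \Po ('X + h%:P) - P)); last first.
  by rewrite (leq_trans (size_poly_shiftB _ _))//; case: (size P) sP.
congr (iter r fdiff _ k); apply/funext => j.
rewrite /fdiff hornerD hornerN horner_comp hornerD hornerX hornerC -natr1.
by rewrite mulrDl mul1r.
Qed.

(** The iterated difference annihilates [P], so only [g - P] at the nodes contributes. *)
Lemma iter_fdiff_approx r P (g : R -> R) (h e : R) k : (size P <= r)%N ->
  (forall j, (k <= j <= k + r)%N -> `|g (j%:R * h) - P.[j%:R * h]| <= e) ->
  `|iter r fdiff (fun j => g (j%:R * h)) k| <= 2 ^+ r * e.
Proof.
move=> sP ge; rewrite -[X in `|X|]subr0 -(iter_fdiff_poly h k sP) -iter_fdiffB.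
exact: iter_fdiff_le.
Qed.

(** A formal polynomial makes differentiation algebraic; the coefficients form an arbitrary sequence
    because each derivative replaces it by its differences. *)
Definition bern_poly m a : {poly R} :=
  \sum_(k < m.+1) a k *: (('X^k * (1 - 'X) ^+ (m - k)) *+ 'C(m, k)).

Lemma horner_bern_poly m a x : (bern_poly m a).[x] = \sum_(k < m.+1) a k * bern m k x.
Proof.
rewrite horner_sum; apply: eq_bigr => k _; rewrite hornerZ hornerMn hornerM.
rewrite horner_exp !hornerE /bern -mulr_natl.
by rewrite /= !mulrA.
Qed.

Lemma bern_polyB m a b : bern_poly m (fun k => a k - b k) = bern_poly m a - bern_poly m b.
Proof. by rewrite /bern_poly -sumrB; apply: eq_bigr => k _; rewrite scalerBl. Qed.

(* De Casteljau's recursion. *)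
Lemma bern_polyS m a : bern_poly m.+1 a =
  (1 - 'X) * bern_poly m a + 'X * bern_poly m (fun k => a k.+1).
Proof.
pose b l k : {poly R} := ('X^k * (1 - 'X) ^+ (l - k)) *+ 'C(l, k).
have bS k : b m.+1 k.+1 = (1 - 'X) * b m k.+1 + 'X * b m k.
  rewrite /b subSS binS mulrnDr exprS; congr (_ + _); last first.
    by rewrite mulrnAr mulrA.
  have [mk|km] := ltnP k m; last by rewrite bin_small// !mulr0n mulr0.
  by rewrite mulrnAr -(subnSK mk) [(1 - 'X) ^+ _.+1]exprS mulrCA.
(* A vanishing term is added so that both sides run over the same indices. *)
have -> : bern_poly m a = \sum_(k < m.+2) a k *: b m k.
  by rewrite big_ord_recr/= /b bin_small// mulr0n scaler0 addr0.
rewrite /bern_poly big_ord_recl [in RHS]big_ord_recl/= mulrDr -addrA.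
congr (_ + _).
  by rewrite -scalerAr /b !bin0 !subn0 !expr0 !mul1r !mulr1n exprS.
rewrite !mulr_sumr -big_split/=; apply: eq_bigr => k _.
rewrite /bump/= add1n -/(b m.+1 k.+1) bS scalerDr -!scalerAr.
by [].
Qed.

(** Differentiating [bern_polyS], the factors [1 - 'X] and ['X] contribute one copy of
    [bern_poly m (fdiff a)]; by induction the same recursion reassembles the other terms into [m]
    more copies. *)
Lemma deriv_bern_poly m a : deriv (bern_poly m a) = m%:R *: bern_poly m.-1 (fdiff a).
Proof.
elim: m a => [|m ih] a.
  by rewrite scale0r /bern_poly big_ord1 !expr0 mulr1 bin0 mulr1n derivZ derivC scaler0.
rewrite bern_polyS derivD !derivM derivB derivX derivC !ih sub0r mulN1r mul1r.
have e : bern_poly m (fdiff a) = bern_poly m (fun k => a k.+1) - bern_poly m a.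
  exact: bern_polyB.
rewrite -[in RHS]natr1 scalerDl scale1r succnK {2}e.
case: m {ih} e => [|m] e /=.
  by rewrite !scale0r !mulr0 !addr0 add0r addrC.
rewrite [in RHS]bern_polyS scalerDr !scalerAr /=.
by ring.
Qed.

Lemma derivn_bern_poly m a r :
  derivn r (bern_poly m a) = (m ^_ r)%:R *: bern_poly (m - r) (iter r fdiff a).
Proof.
elim: r => [|r ih]; first by rewrite derivn0 ffactn0 scale1r subn0.
by rewrite derivnS ih derivZ deriv_bern_poly scalerA -natrM ffactnSr subnS.
Qed.

Lemma derive1n_horner r P : derive1n r (horner P) = horner (derivn r P).
Proof. by elim: r => [//|r ih]; rewrite /derive1n iterS -/(derive1n r _) ih derivnS derivE. Qed.

Lemma derive1n_bernstein_comb s N c n (g : R -> R) r x :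
  derive1n r (bernstein_comb s N c n g) x =
  \sum_(i < s) c n i * ((N n i ^_ r)%:R * \sum_(k < (N n i - r).+1)
     iter r fdiff (fun j => g (j%:R / (N n i)%:R)) k * bern (N n i - r) k x).
Proof.
pose P := \sum_(i < s) c n i *: bern_poly (N n i) (fun j => g (j%:R / (N n i)%:R)).
have -> : bernstein_comb s N c n g = horner P.
  apply/funext => y; rewrite /P horner_sum; apply: eq_bigr => i _.
  by rewrite hornerZ horner_bern_poly.
rewrite derive1n_horner /P linear_sum horner_sum; apply: eq_bigr => i _.
by rewrite linearZ hornerZ/= derivn_bern_poly hornerZ horner_bern_poly.
Qed.

End BernsteinDerivative.

(** * The modified function *)

Section ModifiedFunction.
Context {R : realType}.
Implicit Types (f psi : R -> R) (P : {poly R}).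

(** The basis polynomial is a product of ratios [(y - t j) / (t i - t j)], each at most [Lam] in
    absolute value; the absent factor [j = i] counts as 1. *)
Lemma lagrange_basis_le r (t : nat -> R) (i : 'I_r) (Lam d y : R) :
  0 < d -> 1 <= Lam -> injective t ->
  (forall j, (j < r)%N -> `|y - t j| <= Lam * d) ->
  (forall i j, i != j -> d <= `|t i - t j|) ->
  `|(tnth (lagrange r t) i : {poly R}).[y]| <= Lam ^+ r.
Proof.
move=> d0 Lam1 tinj yt td; have r0 : (0 < r)%N by case: r i {yt} => // -[].
rewrite lagrangeE//= hornerM hornerC !horner_prod -prodfV -big_split/= normr_prod.
rewrite -[X in _ <= _ ^+ X]card_ord -prodr_const big_mkcond/=.
apply: ler_prod => j _; case: ifP => [ji|_]; last by rewrite ler01.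
rewrite normr_ge0/= !hornerXsubC normrM normfV mulrC ler_pdivrMr; last first.
  by rewrite (lt_le_trans d0)// td// eq_sym.
rewrite (le_trans (yt _ (ltn_ord j)))// ler_wpM2l//; first by rewrite (le_trans ler01).
by rewrite td// eq_sym.
Qed.

(** Interpolation reproduces [P], so the error is the interpolant of [f - P], a sum of [r] small
    terms. *)
Lemma lagrange_interp_approx r (t : nat -> R) f P (Lam d y e : R) : (0 < r)%N ->
  0 < d -> 1 <= Lam -> injective t -> (size P <= r)%N ->
  (forall j, (j < r)%N -> `|y - t j| <= Lam * d) ->
  (forall i j, i != j -> d <= `|t i - t j|) ->
  (forall j, (j < r)%N -> `|f (t j) - P.[t j]| <= e) ->
  `|lagrange_interp r t f y - P.[y]| <= r%:R * Lam ^+ r * e.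
Proof.
move=> r0 d0 Lam1 tinj sP yt td fP.
rewrite {1}(lagrange_gen r0 tinj sP) horner_sum /lagrange_interp -sumrB.
rewrite (le_trans (ler_norm_sum _ _ _))//.
rewrite (@le_trans _ _ (\sum_(i < r) Lam ^+ r * e))//; last first.
  by rewrite sumr_const card_ord -[leLHS]mulr_natl mulrA.
apply: ler_sum => i _; rewrite hornerM hornerC -mulrBl normrM mulrC.
by rewrite ler_pM ?fP//; exact: lagrange_basis_le td.
Qed.

Lemma convex_approx (u v p e th : R) : 0 <= th -> th <= 1 ->
  `|u - p| <= e -> `|v - p| <= e -> `|(1 - th) * u + th * v - p| <= e.
Proof.
move=> th0 th1 ue ve.
have -> : (1 - th) * u + th * v - p = (1 - th) * (u - p) + th * (v - p) by ring.
rewrite (le_trans (ler_normD _ _))// !normrM (ger0_norm th0) ger0_norm ?subr_ge0//.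
have -> : e = (1 - th) * e + th * e by ring.
by rewrite lerD// ler_wpM2l ?subr_ge0.
Qed.

Lemma smooth_cutoff_bound psi x : smooth_cutoff psi -> 0 <= psi x /\ psi x <= 1.
Proof.
move=> [nd _ p0 p1]; split.
  have [x0|x0] := leP x 0; first by rewrite p0.
  by rewrite -(p0 0 (lexx _)) nd// ltW.
have [x1|x1] := leP 1 x; first by rewrite p1.
by rewrite -(p1 1 (lexx _)) nd// ltW.
Qed.

Lemma node_dist n i j : (0 < n)%N -> i != j ->
  (n%:R^-1 : R) <= `|i.+1%:R / n%:R - j.+1%:R / n%:R|.
Proof.
move=> n0; wlog ij : i j / (i < j)%N => [hw|_].
  rewrite neq_ltn => /orP[ij|ji]; first by apply: hw; rewrite // lt_eqF.
  by rewrite distrC; apply: hw; rewrite // lt_eqF.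
rewrite distrC -mulrBl normrM gtr0_norm ?subr_gt0 ?ltr_nat//.
rewrite [X in _ * X]ger0_norm ?invr_ge0// ler_peMl ?invr_ge0//.
by rewrite lerBrDr nat1r ler_nat.
Qed.

Lemma node_inj n : (0 < n)%N -> injective (fun i => i.+1%:R / n%:R : R).
Proof.
move=> n0 i j ij; apply/eqP; have := node_dist n0 (i := i) (j := j).
case: eqVneq => // _ /(_ isT); rewrite ij subrr normr0 leNgt.
by rewrite invr_gt0 ltr0n n0.
Qed.

(** The value at [y] is that of [f], of an interpolant, or a convex combination of the two. The
    three implications place in [[p, q]] the points it uses: left nodes, right nodes or [y]
    itself. *)
Lemma modif_approx psi r n f P (e p q y : R) : smooth_cutoff psi ->
  (2 <= r)%N -> (r < n)%N -> (3 < n)%N -> (size P <= r)%N -> 0 <= e ->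
  (forall x, p <= x <= q -> `|f x - P.[x]| <= e) ->
  0 <= y <= 1 ->
  (y <= 2 / n%:R -> p <= 1 / n%:R /\ r%:R / n%:R <= q) ->
  (1 - 2 / n%:R <= y -> p <= 1 - r%:R / n%:R /\ 1 - 1 / n%:R <= q) ->
  (1 / n%:R <= y <= 1 - 1 / n%:R -> p <= y <= q) ->
  `|modif psi r n f y - P.[y]| <= r%:R * r.+2%:R ^+ r * e.
Proof.
move=> psiP r2 rn n3 sP e0 fP /andP[y0 y1] Hl Hr Hm.
have n0 : (0 < n)%N by exact: leq_ltn_trans rn.
have nR0 : 0 < (n%:R : R) by rewrite ltr0n.
have h0 : 0 < (n%:R^-1 : R) by rewrite invr_gt0.
have rh j : (j < r)%N -> (j.+1%:R / n%:R : R) <= r%:R / n%:R.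
  by move=> jr; rewrite ler_pM2r// ler_nat.
have h1 j : 1 / n%:R <= (j.+1%:R / n%:R : R) by rewrite ler_pM2r// ler1n.
have rh1 : (r%:R / n%:R : R) <= 1 - 1 / n%:R.
  by rewrite lerBrDr -mulrDl ler_pdivrMr// mul1r natr1 ler_nat.
have h4 : (4 / n%:R : R) <= 1 by rewrite ler_pdivrMr// mul1r ler_nat.
have r1 : 1 <= (r.+2%:R : R) by rewrite ler1n.
(* A point of [[0, 2 / n]] is within [(r + 2) / n] of the nodes, which are at most [r / n]; this
   fixes the ratio [r.+2], on the right end as well. *)
have rS : (r.+2%:R : R) * n%:R^-1 = r%:R / n%:R + 2 / n%:R.
  by rewrite -mulrDl -natrD addn2.
(* The interpolation constant is at least 1, so it also covers the values of [f] itself. *)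
have eE : e <= r%:R * r.+2%:R ^+ r * e.
  have r1' : 1 <= (r%:R : R) by rewrite ler1n; exact: leq_trans r2.
  by apply: ler_peMl => //; apply: mulr_ege1 => //; exact: exprn_ege1.
have EL : y <= 2 / n%:R -> `|left_interp r n f y - P.[y]| <= r%:R * r.+2%:R ^+ r * e.
  move=> yh; have [ph qh] := Hl yh.
  apply: (@lagrange_interp_approx _ _ _ _ _ n%:R^-1) => //.
  - exact: ltnW.
  - exact: node_inj.
  - move=> j jr; have := h1 j; have := rh j jr; rewrite rS.
    set h := n%:R^-1 in h4 yh *; set a := _ / _ => ? ?; rewrite ler_norml; lra.
  - by move=> i j; exact: node_dist.
  - by move=> j jr; apply: fP; rewrite (le_trans ph) ?h1//= (le_trans _ qh) ?rh.
have ER : 1 - 2 / n%:R <= y -> `|right_interp r n f y - P.[y]| <= r%:R * r.+2%:R ^+ r * e.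
  move=> yh; have [ph qh] := Hr yh.
  apply: (@lagrange_interp_approx _ _ _ _ _ n%:R^-1) => //.
  - exact: ltnW.
  - by move=> i j /addrI/oppr_inj; exact: node_inj.
  - move=> j jr; have := h1 j; have := rh j jr; rewrite rS.
    set h := n%:R^-1 in h4 yh *; set a := _ / _ => ? ?; rewrite ler_norml; lra.
  - by move=> i j ij; rewrite opprB addrC addrA subrK distrC node_dist.
  - move=> j jr; apply: fP; have := h1 j; have := rh j jr; lra.
have EM : 1 / n%:R <= y <= 1 - 1 / n%:R -> `|f y - P.[y]| <= r%:R * r.+2%:R ^+ r * e.
  by move=> /Hm /fP /le_trans; apply.
have psib x := smooth_cutoff_bound x psiP.
rewrite /modif; cbv zeta; case: (leP y (1 / n%:R)) => c1.
  by apply: EL; move: h4 c1; set h := n%:R^-1 in h0 *; lra.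
case: (leP y (2 / n%:R)) => c2.
  apply: convex_approx; [exact: (psib _).1|exact: (psib _).2|exact: EL|apply: EM].
  by apply/andP; move: h4 c1 c2; set h := n%:R^-1 in h0 *; lra.
case: (leP y (1 - 2 / n%:R)) => c3.
  by apply: EM; apply/andP; move: h4 c1 c2 c3; set h := n%:R^-1 in h0 *; lra.
case: (leP y (1 - 1 / n%:R)) => c4.
  apply: convex_approx; [exact: (psib _).1|exact: (psib _).2|by apply: ER; exact: ltW|apply: EM].
  by rewrite c4 ltW.
by apply: ER; exact: ltW.
Qed.

(* Here [h = 1/n] and [eta = 1/m]; the grid window is [[u, u + rho * eta]]. *)
Lemma sampling_window (rho h eta u : R) : 2 <= rho -> 0 < eta -> eta <= h ->
  (rho + 1) * h <= 1 -> 4 * h <= 1 -> 0 <= u -> u + rho * eta <= 1 ->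
  exists p q, [/\ [/\ h <= p, p <= q & q <= 1 - h], q - p <= (rho + 2) * h,
      u + eta <= (rho + 3) * p, 1 - (u + rho * eta) + eta <= (rho + 3) * (1 - q) &
    forall y, u <= y <= u + rho * eta ->
      [/\ y <= 2 * h -> p <= h /\ rho * h <= q,
          1 - 2 * h <= y -> p <= 1 - rho * h /\ 1 - h <= q &
          h <= y <= 1 - h -> p <= y <= q]].
Proof.
move=> rho2 eta0 etah rhoh h4 u0 u1.
(* The window is enlarged by [h] on both sides, extended so that [q >= rho * h] and
   [p <= 1 - rho * h], and clipped to [[h, 1 - h]]. If it meets [[0, 2 * h]], then [p = h] and all
   left nodes are covered; the right end is symmetric. *)
pose p := Num.max h (Num.min (u - h) (1 - rho * h)).
pose q := Num.min (1 - h) (Num.max (u + rho * eta + h) (rho * h)).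
have a2 : 2 * h <= rho * h by rewrite ler_pM2r//; lra.
have b2 : 2 * eta <= rho * eta by rewrite ler_pM2r.
have ba : rho * eta <= rho * h by rewrite ler_pM2l//; lra.
have hp : h <= p by rewrite /p le_max lexx.
have qh : q <= 1 - h by rewrite /q ge_min lexx.
have rp : rho * h <= rho * p by rewrite ler_pM2l//; lra.
have rq : rho * h <= rho * (1 - q) by rewrite ler_pM2l//; lra.
(* Products with [rho] are expanded and named, and the extrema replaced by the alternatives [P1] to
   [Q3]; what remains is linear. *)
exists p, q; move: rp rq hp qh rhoh; rewrite !mulrDl !mulrDr !mulrN mul1r mulr1.
set a := rho * h in a2 ba p q *; set b := rho * eta in b2 ba q u1 *.
set c := rho * p; set c' := rho * q => rp rq hp qh rhoh.
have P1 : p = h \/ p = u - h \/ p = 1 - a.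
  by rewrite /p maxElt minElt; case: ifP => _; [case: ifP => _; right; [left|right]|left].
have P2 : u - h <= p \/ 1 - a <= p.
  rewrite /p !le_max minElt.
  by case: ifP => _; [left|right]; rewrite lexx orbT.
have P3 : p <= h \/ p <= u - h /\ p <= 1 - a.
  have X1 : Num.min (u - h) (1 - a) <= u - h by rewrite ge_min lexx.
  have X2 : Num.min (u - h) (1 - a) <= 1 - a by rewrite ge_min lexx orbT.
  by rewrite /p; case: (leP h (Num.min (u - h) (1 - a))) => _; [right|left].
have Q2 : q <= u + b + h \/ q <= a.
  rewrite /q !ge_min maxElt.
  by case: ifP => _; [right|left]; rewrite lexx orbT.
have Q3 : 1 - h <= q \/ u + b + h <= q /\ a <= q.
  have X1 : u + b + h <= Num.max (u + b + h) a by rewrite le_max lexx.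
  have X2 : a <= Num.max (u + b + h) a by rewrite le_max lexx orbT.
  by rewrite /q; case: (leP (1 - h) (Num.max (u + b + h) a)) => _; [left|right].
split.
- by split => //; lra.
- lra.
- lra.
- lra.
- move=> y /andP[uy yu]; split.
  + by move=> y2; lra.
  + by move=> y2; lra.
  + by move=> /andP[y1 y2]; apply/andP; lra.
Qed.

End ModifiedFunction.

(** * Weights *)

Section Weights.
Context {R : realType}.
Implicit Types (a b x y p q : R) (w f phi : R -> R).
Notation mu := (@lebesgue_measure R).

Lemma powR_le a x y : 0 <= a -> 0 <= x -> x <= y -> x `^ a <= y `^ a.
Proof. by move=> a0 x0 xy; rewrite ge0_ler_powR// nnegrE// (le_trans x0). Qed.

Lemma powR_le1 a x : 0 <= a -> 0 <= x -> x <= 1 -> x `^ a <= 1.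
Proof. by move=> a0 x0 x1; rewrite (le_trans (powR_le a0 x0 x1))// powR1. Qed.

Lemma powR_div a x y : 0 <= x -> 0 < y -> x `^ a / y `^ a = (x / y) `^ a.
Proof.
move=> x0 y0; have y0a : y `^ a != 0 by rewrite gt_eqF ?powR_gt0.
have xy0 : 0 <= x / y by rewrite divr_ge0// ltW.
have <- : (x / y) `^ a * y `^ a = x `^ a by rewrite -powRM ?(ltW y0)// divfK ?gt_eqF.
by rewrite mulfK.
Qed.

Lemma lerV_bounds (M M' v z : R) : 0 < M -> M <= M' -> 0 <= v ->
  M^-1 * v <= z <= M * v -> M'^-1 * v <= z <= M' * v.
Proof.
move=> M0 MM' v0 /andP[h1 h2]; have M'0 := lt_le_trans M0 MM'.
rewrite (le_trans _ h1) ?(le_trans h2) ?ler_wpM2r//.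
by rewrite lef_pV2// posrE.
Qed.

Lemma jacobi_weight_gt0 a b x : 0 < x < 1 -> 0 < jacobi_weight a b x.
Proof. by move=> /andP[x0 x1]; rewrite /jacobi_weight mulr_gt0 ?powR_gt0// subr_gt0. Qed.

(** Near each endpoint the factor belonging to the other one lies between positive constants, and on
    the compact middle part both factors do; one constant serves all three ranges. *)
Lemma step_weight_sim phi b0 b1 : step_weight phi b0 b1 -> exists2 M, 0 < M &
  forall x, 0 < x < 1 -> M^-1 * jacobi_weight b0 b1 x <= phi x <= M * jacobi_weight b0 b1 x.
Proof.
move=> [phim b00 b10 [C0 C00 [e0 /= e00 H0]] [C1 C10 [e1 /= e10 H1]]].
(* Below both radii of validity; the bound 1/2 keeps the factor of the far endpoint at least [d0] or
   [d1]. *)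
pose e := Num.min (2^-1) (Num.min e0 e1 / 2).
have e2 : e <= 2^-1 by rewrite ge_min lexx.
have egt0 : 0 < e by rewrite lt_min invr_gt0 ltr0n/= divr_gt0// lt_min e00.
have ee : e <= Num.min e0 e1 / 2 by rewrite ge_min lexx orbT.
have ee0 : e < e0.
  by rewrite (le_lt_trans ee)// ltr_pdivrMr// (@le_lt_trans _ _ e0) ?ge_min ?lexx// ltr_pMr// ltr1n.
have ee1 : e < e1.
  by rewrite (le_lt_trans ee)// ltr_pdivrMr// (@le_lt_trans _ _ e1)
    ?ge_min ?lexx ?orbT// ltr_pMr// ltr1n.
have [M2 M20 HM] := phim e (1 - e) egt0 (ltac:(lra)) (ltac:(lra)).
pose d0 := (2^-1 : R) `^ b1; pose d1 := (2^-1 : R) `^ b0; pose d2 := e `^ b0 * e `^ b1.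
have d00 : 0 < d0 by rewrite powR_gt0.
have d10 : 0 < d1 by rewrite powR_gt0.
have d20 : 0 < d2 by rewrite mulr_gt0// powR_gt0.
pose M := (C0 + C0 / d0) + (C1 + C1 / d1) + (M2 + M2 / d2).
have pos (c d : R) : 0 < c -> 0 < d -> 0 < c + c / d by move=> ? ?; rewrite addr_gt0// divr_gt0.
have q0 := pos _ _ C00 d00; have q1 := pos _ _ C10 d10; have q2 := pos _ _ M20 d20.
have cM0 : C0 + C0 / d0 <= M by rewrite /M; lra.
have cM1 : C1 + C1 / d1 <= M by rewrite /M; lra.
have cM2 : M2 + M2 / d2 <= M by rewrite /M; lra.
have M0 : 0 < M by rewrite (lt_le_trans q0).
exists M => // x /andP[x0 x1].
have D0 : 0 < jacobi_weight b0 b1 x by apply: jacobi_weight_gt0; rewrite x0.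
(* Replacing [Y] by the weight costs [c] in the lower bound and [c / d] in the upper one; their sum
   serves for both. *)
have key c d Y : 0 < c -> 0 < d -> c + c / d <= M ->
    d * Y <= jacobi_weight b0 b1 x -> jacobi_weight b0 b1 x <= Y ->
    c^-1 * Y <= phi x <= c * Y ->
    M^-1 * jacobi_weight b0 b1 x <= phi x <= M * jacobi_weight b0 b1 x.
  move=> c0 d0' cM dY DY /andP[h1 h2].
  apply: (lerV_bounds (pos c d c0 d0') cM (ltW D0)); apply/andP; split.
    rewrite (le_trans _ h1)// ler_pM ?invr_ge0 ?(ltW D0) ?(ltW (pos _ _ _ _))//.
    by rewrite lef_pV2 ?posrE ?pos// lerDl divr_ge0// ltW.
  rewrite (le_trans h2)//.
  rewrite (@le_trans _ _ (c / d * jacobi_weight b0 b1 x))//.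
    by rewrite -mulrA ler_pM2l// mulrC ler_pdivlMr// mulrC.
  by rewrite ler_pM2r// lerDr ltW.
have [xe|xe] := ltP x e.
  apply: (key C0 d0 (x `^ b0)) => //.
  - rewrite /jacobi_weight mulrC ler_wpM2l ?powR_ge0// powR_le//; lra.
  - rewrite /jacobi_weight ler_piMr ?powR_ge0// powR_le1//; lra.
  - by apply: H0 => //=; rewrite /ball/= sub0r normrN gtr0_norm// (lt_trans xe).
have [xe'|xe'] := ltP (1 - x) e.
  apply: (key C1 d1 ((1 - x) `^ b1)) => //.
  - rewrite /jacobi_weight ler_wpM2r ?powR_ge0// powR_le//; lra.
  - rewrite /jacobi_weight ler_piMl ?powR_ge0// powR_le1//; lra.
  - by apply: H1 => //=; rewrite /ball/= gtr0_norm ?subr_gt0// (lt_trans xe').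
apply: (key M2 d2 1) => //.
- by rewrite mulr1 /jacobi_weight ler_pM ?powR_ge0// powR_le//; lra.
- by rewrite /jacobi_weight mulr_ile1 ?powR_ge0// powR_le1//; lra.
- by rewrite !mulr1; apply: HM; rewrite in_itv/=; apply/andP; lra.
Qed.

Lemma weight_sim phi alpha beta b0 b1 r : step_weight phi b0 b1 -> exists2 M, 0 < M &
  forall x, 0 < x < 1 ->
    M^-1 * jacobi_weight (alpha + b0 * r%:R) (beta + b1 * r%:R) x
      <= jacobi_weight alpha beta x * phi x ^+ r
      <= M * jacobi_weight (alpha + b0 * r%:R) (beta + b1 * r%:R) x.
Proof.
move=> /step_weight_sim[M M0 H]; exists (M ^+ r); first by rewrite exprn_gt0.
move=> x x01; have /andP[h1 h2] := H x x01; have /andP[x0 x1] := x01.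
have D0 := jacobi_weight_gt0 b0 b1 x01; have W0 := jacobi_weight_gt0 alpha beta x01.
have -> : jacobi_weight (alpha + b0 * r%:R) (beta + b1 * r%:R) x =
    jacobi_weight alpha beta x * jacobi_weight b0 b1 x ^+ r.
  have xn : x != 0 by rewrite gt_eqF.
  have xn' : 1 - x != 0 by rewrite gt_eqF ?subr_gt0.
  rewrite /jacobi_weight !powRD ?xn ?xn' ?implybT//.
  by rewrite !powRrM !powR_mulrn ?powR_ge0// exprMn; ring.
rewrite -exprVn !(mulrCA _ (jacobi_weight alpha beta x)) -!exprMn !ler_pM2l//.
have l0 : 0 <= M^-1 * jacobi_weight b0 b1 x by rewrite mulr_ge0 ?invr_ge0 ?ltW.
by rewrite !lerXn2r ?nnegrE// ?(le_trans l0)// (le_trans h1).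
Qed.

Lemma esssup_norm01_ge0 g : (0 <= @esssup_norm01 R g)%E.
Proof. exact: Lnorm_ge0. Qed.

Lemma esssup_norm01_ae g : (@esssup_norm01 R g < +oo)%E ->
  {ae mu, forall x, 0 < x < 1 -> `|g x| <= fine (esssup_norm01 g)}.
Proof.
move=> goo; have gfin : esssup_norm01 g \is a fin_num.
  by rewrite ge0_fin_numE// esssup_norm01_ge0.
pose G := ((EFin \o g) \_ `]0, 1[%classic : R -> \bar R).
have : {ae mu, forall x, (`|G x| <= esssup_norm01 g)%E}.
  have : (ess_sup mu (abse \o G) <= esssup_norm01 g)%E.
    (* The norm is defined by cases on whether the line has positive measure. *)
    rewrite /esssup_norm01 unlock; case: ifPn => //.
    have E : (0 < mu [set: R])%E.
      have := @lebesgue_measure_itv R `]-oo, +oo[; rewrite set_itvNyy => ->.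
      by rewrite /= lt0y.
    by move=> /negP [].
  by move/ess_supP.
apply: filterS; first exact: (ae_filter_ringOfSetsType mu).
move=> x + x01; rewrite /G patchE mem_set/=; last by rewrite in_itv.
by rewrite -lee_fin fineK.
Qed.

(** A lower bound of the weight around [[p, q]] turns the weighted norm into an almost everywhere
    bound on the derivative of order [r]; the derivative of order [r - 1] is then Lipschitz and
    [polynomial_approximation] applies. *)
Lemma Wphi_polynomial_approximation alpha beta phi b0 b1 r : (0 < r)%N ->
  0 <= alpha -> 0 <= beta -> step_weight phi b0 b1 ->
  exists2 M, 0 < M & forall f, in_Wphi (jacobi_weight alpha beta) phi r f ->
  forall p q, 0 < p -> p <= q -> q < 1 ->
  exists2 P : {poly R}, (size P <= r)%N & forall x, p <= x <= q ->
    `|f x - P.[x]| <= M *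
       fine (esssup_norm01 (fun x => jacobi_weight alpha beta x * phi x ^+ r * derive1n r f x))
       / ((p / 2) `^ (alpha + b0 * r%:R) * ((1 - q) / 2) `^ (beta + b1 * r%:R)) * (q - p) ^+ r.
Proof.
move=> r0 al0 be0 st; have [M M0 HM] := weight_sim alpha beta r st.
have [_ b00 b10 _ _] := st.
exists M => // f [_ fd fac foo] p q p0 pq q1.
set E := fine _; set a := alpha + _; set b := beta + _.
have a0 : 0 <= a by rewrite addr_ge0// mulr_ge0.
have b0' : 0 <= b by rewrite addr_ge0// mulr_ge0.
have E0 : 0 <= E by rewrite fine_ge0// esssup_norm01_ge0.
set S := _ / _; have p2 : 0 < p / 2 by rewrite divr_gt0.
have q2 : 0 < (1 - q) / 2 by rewrite divr_gt0// subr_gt0.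
have den0 : 0 < (p / 2) `^ a * ((1 - q) / 2) `^ b by rewrite mulr_gt0// powR_gt0.
have S0 : 0 <= S by rewrite divr_ge0 ?(ltW den0)// mulr_ge0// ltW.
(* Halving the distances to 0 and 1 leaves room around [[p, q]], since the Lipschitz bound holds in
   an open interval. *)
pose c := p / 2; pose d := 1 - (1 - q) / 2.
have fS : {ae mu, forall x, c < x < d -> `|derive1 (derive1n r.-1 f) x| <= S}.
  have := esssup_norm01_ae foo; apply: filterS; first exact: (ae_filter_ringOfSetsType mu).
  move=> x H /andP[cx xd]; have x01 : 0 < x < 1.
    by rewrite (lt_trans _ cx)//= (lt_trans xd)// /d gtrBl.
  have := H x01; rewrite -/E.
  have -> : derive1n r f = derive1 (derive1n r.-1 f) by rewrite -{1}(prednK r0).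
  have /andP[h _] := HM x x01; rewrite -/a -/b in h.
  have D0 := jacobi_weight_gt0 a b x01.
  have w0 : 0 < jacobi_weight alpha beta x * phi x ^+ r.
    by rewrite (lt_le_trans _ h)// mulr_gt0// invr_gt0.
  rewrite normrM (gtr0_norm w0) -ler_pdivlMl// => /le_trans; apply.
  rewrite /S [leRHS]mulrAC; apply: ler_wpM2r => //.
  rewrite -[M]invrK -invfM lef_pV2 ?posrE//; last by rewrite mulr_gt0// invr_gt0.
  rewrite (le_trans _ h)// ler_pM2l ?invr_gt0// /jacobi_weight.
  by rewrite ler_pM ?powR_ge0// powR_le//; rewrite /c /d in cx xd; lra.
have cd : c < d by rewrite /c /d; lra.
have d1 : d < 1 by rewrite /d; lra.
have lip := abs_continuous_lipschitz S0 (fac c d p2 cd d1) fS.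
have [||P sP fP] := @polynomial_approximation _ r.-1 f p q S S0 pq.
- move=> i ir x; rewrite in_itv/= => /andP[px xq]; apply: fd => //.
  by rewrite in_itv/= (lt_le_trans p0 px) (le_lt_trans xq q1).
- by move=> x y px xy yq; apply: lip => //; rewrite /c /d; lra.
by exists P; rewrite ?(prednK r0) in sP fP *.
Qed.

End Weights.

(** * The main estimate *)

Section Estimate.
Context {R : realType}.
Implicit Types (a b x p q : R) (f phi psi : R -> R).

(** Converts the ratio left by the weights into the one of [bern_powR_sum]; at the right end [1 - x]
    and [1 - q] replace [x] and [p]. *)
Lemma ratio_le (x p k1 l1 m c d : R) : 0 <= x -> 0 < p -> 0 < k1 -> 0 < m -> 0 < c ->
  k1 / m <= c * p -> m <= d * l1 -> x / (p / 2) <= 2 * c * d * (l1 * x / k1).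
Proof.
move=> x0 p0 k10 m0 c0 kc md; rewrite ler_pdivrMr ?divr_gt0//.
have -> : 2 * c * d * (l1 * x / k1) * (p / 2) = x * (c * p * (d * l1) / k1).
  by field; rewrite gt_eqF.
rewrite ler_peMr// ler_pdivlMr// mul1r.
rewrite ler_pdivrMr// in kc; rewrite (le_trans kc)// ler_wpM2l// mulr_ge0// ltW//.
Qed.

(** Origin of the constants: [2 ^+ r] from the differences, [r%:R * r.+2%:R ^+ r] from
    [modif_approx], [(r.+2%:R * K) ^+ r] from the bound on [m (q - p)], and [2 * r.+3%:R * r.+1%:R]
    from halving [p], from [(k + 1) / m <= (r + 3) p] and from [m <= (r + 1) (m - r + 1)]. *)
Lemma modif_fdiff_le psi r n m k (K A : R) a b f : smooth_cutoff psi ->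
  (2 <= r)%N -> (r < n)%N -> (3 < n)%N -> (n <= m)%N -> m%:R <= K * n%:R ->
  (k <= m - r)%N -> 0 <= A -> 0 <= a -> 0 <= b ->
  (forall p q, 0 < p -> p <= q -> q < 1 ->
    exists2 P : {poly R}, (size P <= r)%N & forall x, p <= x <= q ->
      `|f x - P.[x]| <= A / ((p / 2) `^ a * ((1 - q) / 2) `^ b) * (q - p) ^+ r) ->
  forall x, 0 < x < 1 ->
  m%:R ^+ r * `|iter r fdiff (fun j => modif psi r n f (j%:R / m%:R)) k| * jacobi_weight a b x <=
  2 ^+ r * (r%:R * r.+2%:R ^+ r) * (r.+2%:R * K) ^+ r * A *
   ((2 * r.+3%:R * r.+1%:R * ((m - r).+1%:R * x / k.+1%:R)) `^ a *
    (2 * r.+3%:R * r.+1%:R * ((m - r).+1%:R * (1 - x) / (m - r - k).+1%:R)) `^ b).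
Proof.
move=> psiP r2 rn n3 nm mK km A0 a0 b0 H x /andP[x0 x1].
have rm : (r < m)%N by exact: leq_trans nm.
have n0 : 0 < (n%:R : R) by rewrite ltr0n (leq_ltn_trans _ rn).
have m0 : 0 < (m%:R : R) by rewrite ltr0n (leq_ltn_trans _ rm).
have krm : (k + r <= m)%N by rewrite addnC -leq_subRL// ltnW.
have h0 : 0 < (n%:R^-1 : R) by rewrite invr_gt0.
have e0 : 0 < (m%:R^-1 : R) by rewrite invr_gt0.
have w1 : 2 <= (r%:R : R) by rewrite ler_nat.
have w3 : (m%:R^-1 : R) <= n%:R^-1 by rewrite lef_pV2 ?posrE// ler_nat.
have w4 : (r%:R + 1) * n%:R^-1 <= 1 :> R by rewrite natr1 ler_pdivrMr// mul1r ler_nat.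
have w5 : 4 * n%:R^-1 <= 1 :> R by rewrite ler_pdivrMr// mul1r ler_nat.
have w6 : 0 <= (k%:R / m%:R : R) by rewrite divr_ge0// ltW.
have w7 : k%:R / m%:R + r%:R * m%:R^-1 <= 1 :> R.
  by rewrite -mulrDl -natrD ler_pdivrMr// mul1r ler_nat.
have [p [q [[hp pq qh] qp pk qk Hy]]] := sampling_window w1 e0 w3 w4 w5 w6 w7.
have p0 : 0 < p by rewrite (lt_le_trans h0).
have q1 : q < 1 by rewrite (le_lt_trans qh)// gtrBl.
have [P sP fP] := H p q p0 pq q1.
pose D := (p / 2) `^ a * ((1 - q) / 2) `^ b; pose eps := A / D * (q - p) ^+ r.
have {}fP : forall x, p <= x <= q -> `|f x - P.[x]| <= eps := fP.
have p20 : 0 < p / 2 by rewrite divr_gt0.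
have q20 : 0 < (1 - q) / 2 by rewrite divr_gt0// subr_gt0.
have D0 : 0 < D by rewrite mulr_gt0// powR_gt0.
have qp0 : 0 <= q - p by rewrite subr_ge0.
have eps0 : 0 <= eps by rewrite mulr_ge0 ?exprn_ge0// divr_ge0// ltW.
have T : `|iter r fdiff (fun j => modif psi r n f (j%:R / m%:R)) k| <=
    2 ^+ r * (r%:R * r.+2%:R ^+ r * eps).
  apply: (iter_fdiff_approx sP) => j /andP[kj jk].
  have uy : k%:R / m%:R <= (j%:R / m%:R : R) <= k%:R / m%:R + r%:R * (m%:R^-1 : R).
    by rewrite -mulrDl -natrD !ler_pM2r// !ler_nat kj.
  have [Hy1 Hy2 Hy3] := Hy _ uy.
  apply: (modif_approx psiP r2 rn n3 sP eps0 fP) => //; rewrite ?mul1r//.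
  rewrite divr_ge0 ?(ltW m0)//= ler_pdivrMr// mul1r ler_nat.
  exact: leq_trans jk krm.
set W := jacobi_weight a b x; set G := (X in _ <= _ * X).
have W0 : 0 < W by apply: jacobi_weight_gt0; rewrite x0.
have WD : W / D <= G.
  rewrite /W /D /jacobi_weight invfM mulrACA !powR_div ?(ltW x0) ?subr_ge0 ?(ltW x1)//.
  have ml : (m%:R : R) <= r.+1%:R * (m - r).+1%:R.
    by rewrite -natrM ler_nat -{1}(subnK (ltnW rm)) mulSn leq_add// leq_pmulr.
  rewrite ler_pM ?powR_ge0//; apply: powR_le => //;
    try by rewrite divr_ge0 ?(ltW x0) ?subr_ge0 ?(ltW x1) ?(ltW p20) ?(ltW q20).
  - apply: (@ratio_le _ _ _ _ m%:R) => //; first exact: ltW.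
    by rewrite -natr1 mulrDl mul1r (le_trans pk)// -natrD addn3.
  - apply: (@ratio_le _ _ _ _ m%:R) => //; rewrite ?subr_ge0 ?subr_gt0 ?(ltW x1)//.
    (* Here [1 - (k / m + r / m) + 1 / m = (m - r - k + 1) / m]. *)
    rewrite -[r.+3]addn3 natrD (le_trans _ qk)// -natr1 mulrDl mul1r lerD2r.
    by rewrite -subnDA [(r + k)%N]addnC natrB// natrD mulrBl divff ?gt_eqF// mulrDl.
have mq : m%:R ^+ r * (q - p) ^+ r <= (r.+2%:R * K) ^+ r.
  have mq' : m%:R * (q - p) <= r.+2%:R * K.
    rewrite (le_trans (ler_wpM2l (ltW m0) qp))// -natrD addn2 mulrCA.
    by rewrite ler_wpM2l// ler_pdivrMr.
  have mq0 : 0 <= m%:R * (q - p) by rewrite mulr_ge0// ltW.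
  by rewrite -exprMn lerXn2r ?nnegrE// (le_trans mq0).
apply: (@le_trans _ _ (m%:R ^+ r * (2 ^+ r * (r%:R * r.+2%:R ^+ r * eps)) * W)).
  by rewrite ler_wpM2r ?(ltW W0)// ler_wpM2l// exprn_ge0// ltW.
have -> : m%:R ^+ r * (2 ^+ r * (r%:R * r.+2%:R ^+ r * eps)) * W =
    2 ^+ r * (r%:R * r.+2%:R ^+ r) * A * ((m%:R ^+ r * (q - p) ^+ r) * (W / D)).
  by rewrite /eps; ring.
have -> : 2 ^+ r * (r%:R * r.+2%:R ^+ r) * (r.+2%:R * K) ^+ r * A * G =
    2 ^+ r * (r%:R * r.+2%:R ^+ r) * A * ((r.+2%:R * K) ^+ r * G) by ring.
apply: ler_wpM2l; first by rewrite !mulr_ge0 ?exprn_ge0.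
apply: ler_pM => //; first by rewrite mulr_ge0// exprn_ge0// ltW.
by rewrite divr_ge0// ltW.
Qed.

Lemma ffact_leq_expn m r : (m ^_ r <= m ^ r)%N.
Proof. by elim: r => [//|r ih]; rewrite ffactnSr expnSr leq_mul// leq_subr. Qed.

Lemma comb_data_bounds s (K : R) N c n i : comb_data s K N c -> (0 < n)%N -> (i < s)%N ->
  (n <= N n i)%N /\ (N n i)%:R <= `|K| * n%:R.
Proof.
move=> cd n0 is_; have [[N0 Ninc NK] _ _ _] := cd n n0.
have mono j k : (j + k < s)%N -> (N n j <= N n (j + k))%N.
  elim: k => [|k ih]; first by rewrite addn0.
  rewrite addnS => jk; apply: leq_trans (ih (ltnW jk)) _; apply: ltnW.
  exact: Ninc.
split; first by have := mono 0%N i is_; rewrite add0n N0.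
apply: (@le_trans _ _ (N n s.-1)%:R).
  have e : (i + (s.-1 - i) = s.-1)%N by rewrite subnKC// -ltnS prednK// (leq_ltn_trans _ is_).
  by rewrite ler_nat -e mono// e ltn_predL (leq_ltn_trans _ is_).
by rewrite (le_trans NK)// ler_wpM2r// ler_norm.
Qed.

End Estimate.

Theorem theorem2p2 (R : realType) (r : nat) (alpha beta : R)
    (phi psi : R -> R) (b0 b1 K : R) :
  (2 <= r)%N -> 0 < alpha -> 0 < beta ->
  step_weight phi b0 b1 -> 2^-1 <= Num.min b0 b1 ->
  smooth_cutoff psi ->
  let w := jacobi_weight alpha beta in
  exists2 C : R, 0 < C &
    forall (N : nat -> nat -> nat) (c : nat -> nat -> R),
    comb_data r.-1 K N c ->
    forall f : R -> R, in_Wphi w phi r f ->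
    forall n : nat, (maxn r 3 < n)%N ->
    forall x : R, 0 <= x <= 1 ->
    ((`| w x * phi x ^+ r * derive1n r (bernstein_star psi r N c n f) x |%R)%:E
       <= C%:E * esssup_norm01 (fun y => w y * phi y ^+ r * derive1n r f y)%R)%E.
Proof.
move=> r2 al0 be0 st _ psiP w.
have r0 : (0 < r)%N by exact: ltnW.
have [_ b00 b10 _ _] := st.
pose a := alpha + b0 * r%:R; pose b := beta + b1 * r%:R.
have a0 : 0 <= a by rewrite addr_ge0 ?mulr_ge0// ltW.
have b0' : 0 <= b by rewrite addr_ge0 ?mulr_ge0// ltW.
have [M M0 HM] := weight_sim alpha beta r st.
have [M1 M10 HP] := Wphi_polynomial_approximation r0 (ltW al0) (ltW be0) st.
have kap0 : 0 <= 2 * r.+3%:R * r.+1%:R :> R by rewrite !mulr_ge0.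
have [Cb Cb0 HC] := bern_powR_sum a0 b0' kap0.
(* The constant is fixed before the data that force [K] to be positive, hence the absolute value. *)
pose B := 2 ^+ r * (r%:R * r.+2%:R ^+ r) * (r.+2%:R * `|K|) ^+ r.
have B0 : 0 <= B by rewrite !mulr_ge0 ?exprn_ge0 ?mulr_ge0.
pose C := M * (`|K| * (B * M1 * Cb)).
have C0 : 0 <= C by rewrite !mulr_ge0 ?(ltW M0) ?(ltW M10) ?(ltW Cb0).
(* [C] vanishes when [K = 0]; adding 1 makes the constant positive. *)
exists (C + 1); first by rewrite ltr_wpDl.
move=> N c cd f fW n rn x /andP[x0 x1].
set g := fun y => _; have gfin : esssup_norm01 g \is a fin_num.
  by case: fW => _ _ _ goo; rewrite ge0_fin_numE// esssup_norm01_ge0.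
set E := fine (esssup_norm01 g).
have E0 : 0 <= E by rewrite fine_ge0// esssup_norm01_ge0.
rewrite -(fineK gfin) -/E -EFinM lee_fin.
have CE0 : 0 <= (C + 1) * E by rewrite mulr_ge0// addr_ge0.
(* At the endpoints [w] vanishes because its exponents are positive; [weight_sim] compares the
   weights only inside. *)
have [x0'|x0'] := eqVneq x 0.
  by rewrite x0' /w /jacobi_weight powR0 ?gt_eqF// !mul0r normr0.
have [x1'|x1'] := eqVneq x 1.
  by rewrite x1' /w /jacobi_weight subrr powR0 ?gt_eqF// mulr0 !mul0r normr0.
have x01 : 0 < x < 1 by rewrite !lt_neqAle eq_sym x0' x0 x1' x1.
have xx01 : 0 <= x <= 1 by rewrite x0 x1.
have [r_n n3] : (r < n)%N /\ (3 < n)%N by move: rn; rewrite gtn_max => /andP.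
have n0 : (0 < n)%N by exact: ltn_trans n3.
have W0 := jacobi_weight_gt0 a b x01.
have /andP[wl wu] := HM x x01; rewrite -/a -/b -/w in wl wu.
have wp0 : 0 <= w x * phi x ^+ r.
  by rewrite (le_trans _ wl)// mulr_ge0 ?invr_ge0// ltW.
rewrite normrM (ger0_norm wp0).
apply: (@le_trans _ _ (C * E)); last by rewrite ler_wpM2r// lerDl.
apply: le_trans (ler_wpM2r (normr_ge0 _) wu) _.
have -> : M * jacobi_weight a b x * `|derive1n r (bernstein_star psi r N c n f) x| =
    M * (`|derive1n r (bernstein_star psi r N c n f) x| * jacobi_weight a b x) by ring.
have -> : C * E = M * (`|K| * (B * (M1 * (Cb * E)))) by rewrite /C; ring.
rewrite ler_pM2l// /bernstein_star derive1n_bernstein_comb.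
apply: le_trans (ler_wpM2r (ltW W0) (ler_norm_sum _ _ _)) _.
have [_ cK _ _] := cd n n0.
rewrite mulr_suml.
(* Each Bernstein operator is bounded separately, and the absolute values of the coefficients sum to
   at most [K]. *)
apply: (@le_trans _ _ (\sum_(i < r.-1) `|c n i| * (B * (M1 * (Cb * E))))); last first.
  rewrite -mulr_suml ler_wpM2r ?(le_trans cK) ?ler_norm//.
  by rewrite !mulr_ge0 ?(ltW M10) ?(ltW Cb0).
apply: ler_sum => i _; rewrite normrM -mulrA ler_wpM2l//.
have [nm mK] := comb_data_bounds cd n0 (ltn_ord i).
set m := N n i in nm mK *.
rewrite normrM normr_nat.
set S := \sum_(k < _) _.
have mm : ((m ^_ r)%:R : R) <= m%:R ^+ r by rewrite -natrX ler_nat ffact_leq_expn.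
apply: (@le_trans _ _ (m%:R ^+ r * `|S| * jacobi_weight a b x)).
  by rewrite ler_wpM2r ?(ltW W0)// ler_wpM2r.
apply: (@le_trans _ _ (B * (M1 * E) * Cb)); last by rewrite -!mulrA ![E * _]mulrC !mulrA.
have A0 : 0 <= M1 * E by rewrite mulr_ge0// ltW.
(* The termwise bounds of [modif_fdiff_le], with [A = M1 * E]; their sum is the moment bounded by
   [HC] in degree [m - r]. *)
apply: (@le_trans _ _ (\sum_(k < (m - r).+1) B * (M1 * E) *
  (bern (m - r) k x * (2 * r.+3%:R * r.+1%:R * ((m - r).+1%:R * x / k.+1%:R)) `^ a *
    (2 * r.+3%:R * r.+1%:R * ((m - r).+1%:R * (1 - x) / (m - r - k).+1%:R)) `^ b))); last first.
  rewrite -mulr_sumr; apply: ler_wpM2l; last exact: HC.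
  by rewrite !mulr_ge0// ltW.
rewrite /S; apply: le_trans (ler_wpM2r (ltW W0) (ler_wpM2l _ (ler_norm_sum _ _ _))) _.
  by rewrite exprn_ge0.
rewrite mulr_sumr mulr_suml; apply: ler_sum => k _.
rewrite normrM (ger0_norm (bern_ge0 _ _ xx01)).
have km : (k <= m - r)%N by rewrite -ltnS.
have := modif_fdiff_le psiP r2 r_n n3 nm mK km A0 a0 b0' (HP f fW) x01.
rewrite -/B => /(ler_wpM2r (bern_ge0 (m - r) k xx01)).
set T := iter _ _ _ _; set Y := _ `^ a; set Z := _ `^ b.
rewrite (_ : m%:R ^+ r * `|T| * _ * _ =
  m%:R ^+ r * (`|T| * bern (m - r) k x) * jacobi_weight a b x); last by ring.
by move=> /le_trans; apply; rewrite le_eqVlt; apply/orP; left; apply/eqP; ring.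
Qed.
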